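(* Let $\mathcal C$ be any class of graphs of bounded twin-width and $\mathcal A$ any additive (abelian) group. There is an algorithm that, given any adjacency matrix $M$ of an $n$-vertex graph of $\mathcal C$ (with respect to any ordering of its vertices) and any $n\times n$ matrix $N$ over $\mathcal A$, computes $MN$ in time $O(n^2\log n)$ with high probability, i.e., with probability at least $1-n^{-c}$ for any fixed but arbitrarily large constant $c>0$.
   Context: For a $\{0,1\}$-matrix $M$ and a matrix $N$ over $\mathcal A$, $(MN)_{ij}=\sum_{k:M_{ik}=1}N_{kj}$. Twin-width: a trigraph is a graph whose edges are colored black or red. Contracting two vertices $u,v$ replaces them by a new vertex $w$ such that for every other vertex $x$: $wx$ is black if $ux,vx$ are both black, absent if neither $ux$ nor $vx$ is an edge, and red otherwise. A graph (all edges black) has twin-width at most $d$ if some sequence of contractions reduces it to a single vertex with every intermediate trigraph having maximum red degree at most $d$; a class has bounded twin-width if some $d$ bounds the twin-width of all its members. *)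

(* Defs.v *)
From HB Require Import structures.
From mathcomp Require Import all_boot all_order all_algebra.
From mathcomp Require Import all_classical all_reals all_analysis.

Set Implicit Arguments.
Unset Strict Implicit.
Unset Printing Implicit Defensive.

Import Order.TTheory GRing.Theory Num.Theory.
Import numFieldNormedType.Exports.

Local Open Scope ring_scope.

Record graph := Graph {
  vertex :> finType;
  edge : rel vertex;
  edge_sym : symmetric edge;
  edge_irr : irreflexive edge }.

Inductive colour := NoEdge | Black | Red.

Definition is_red (a : colour) : bool := if a is Red then true else false.

Record trigraph := Trigraph {
  tvertex :> finType;
  tcol : tvertex -> tvertex -> colour;
  tcol_sym : forall x y, tcol x y = tcol y x;
  tcol_irr : forall x, tcol x x = NoEdge }.

Definition red_degree (G : trigraph) (x : G) : nat :=
  #|[set y : G | is_red (tcol x y)]|.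

Definition max_red_degree_le (G : trigraph) (d : nat) : Prop :=
  forall x : G, (red_degree x <= d)%N.

Section AllBlack.
Variable G : graph.

Definition black_col (x y : G) : colour := if edge x y then Black else NoEdge.

Lemma black_col_sym (x y : G) : black_col x y = black_col y x.
Proof. by rewrite /black_col edge_sym. Qed.

Lemma black_col_irr (x : G) : black_col x x = NoEdge.
Proof. by rewrite /black_col edge_irr. Qed.

Definition black_trigraph : trigraph := Trigraph black_col_sym black_col_irr.

End AllBlack.

Section Contract.
Variables (G : trigraph) (u v : G).

Definition merge_col (a b : colour) : colour :=
  match a, b with
  | Black, Black => Black
  | NoEdge, NoEdge => NoEdge
  | _, _ => Red
  end.

(* [None] is the new vertex w; the other vertices are those of G other than
   u and v. *)
Definition contract_vertex : finType := option {x : G | (x != u) && (x != v)}.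

Definition contract_col (a b : contract_vertex) : colour :=
  match a, b with
  | None, None => NoEdge
  | None, Some x | Some x, None =>
      merge_col (tcol u (val x)) (tcol v (val x))
  | Some x, Some y => tcol (val x) (val y)
  end.

Lemma contract_col_sym (a b : contract_vertex) :
  contract_col a b = contract_col b a.
Proof. by case: a b => [x|] [y|] //=; rewrite tcol_sym. Qed.

Lemma contract_col_irr (a : contract_vertex) : contract_col a a = NoEdge.
Proof. by case: a => [x|] //=; rewrite tcol_irr. Qed.

Definition contract : trigraph := Trigraph contract_col_sym contract_col_irr.

End Contract.

(* The base case also covers the trigraph without vertices, so that the empty
   graph has twin-width 0. *)
Inductive contraction_sequence (d : nat) : trigraph -> Prop :=
| ContractionDone (G : trigraph) :
    (#|G| <= 1)%N -> contraction_sequence d G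
| ContractionStep (G : trigraph) (u v : G) :
    u != v -> max_red_degree_le (contract u v) d ->
    contraction_sequence d (contract u v) -> contraction_sequence d G.

Definition twin_width_le (G : graph) (d : nat) : Prop :=
  contraction_sequence d (black_trigraph G).

Definition bounded_twin_width (C : graph -> Prop) : Prop :=
  exists d : nat, forall G : graph, C G -> twin_width_le G d.

(* The ordering of the vertices is the bijection s. *)
Definition adjacency_matrix (G : graph) (n : nat) (M : 'M[bool]_n) : Prop :=
  exists s : 'I_n -> G, bijective s /\ M = \matrix_(i, j) edge (s i) (s j).

Definition bool_mulmx (A : zmodType) (n : nat) (M : 'M[bool]_n) (N : 'M[A]_n) :
  'M[A]_n := \matrix_(i, j) \sum_(k < n | M i k) N k j.

(* The model of computation is a randomized word RAM with group-valued cells.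
  Machine words are naturals below [2 ^ w].  Besides scalar variables, there
  are finitely many (in each program) word arrays, indexed by words.  Elements
  of the abelian group live in variables and arrays of their own, can only be
  copied, added and negated, and cannot influence the control flow. *)

Inductive word_op := OpAdd | OpSub | OpMul | OpDiv | OpMod | OpEq | OpLt.

Inductive word_expr :=
| WConst of nat
| WVar of nat
| WRead of nat & word_expr                        (* array, index *)
| WOp of word_op & word_expr & word_expr.

Inductive group_expr :=
| GZero
| GVar of nat
| GRead of nat & word_expr                        (* array, index *)
| GAdd of group_expr & group_expr
| GOpp of group_expr.

Inductive cmd :=
| Skip
| Seq of cmd & cmd
| If of word_expr & cmd & cmd
| While of word_expr & cmd
| WAssign of nat & word_expr
| WWrite of nat & word_expr & word_expr           (* array, index, value *)
| Flip of nat                                     (* fair coin into a variable *)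
| GAssign of nat & group_expr
| GWrite of nat & word_expr & group_expr.         (* array, index, value *)

Section Semantics.
Variables (A : zmodType) (w : nat).

Record state := State {
  wvar : nat -> nat;
  warr : nat -> nat -> nat;
  gvar : nat -> A;
  garr : nat -> nat -> A;
  coins : seq bool }.                             (* coin tosses still to come *)

Definition word (x : nat) : nat := (x %% 2 ^ w)%N.

(* Subtraction is truncated at 0; division by 0 yields 0. *)
Definition eval_op (o : word_op) (x y : nat) : nat :=
  match o with
  | OpAdd => (x + y)%N
  | OpSub => (x - y)%N
  | OpMul => (x * y)%N
  | OpDiv => (x %/ y)%N
  | OpMod => (x %% y)%N
  | OpEq => (x == y)%N
  | OpLt => (x < y)%N
  end.

Fixpoint eval (s : state) (e : word_expr) : nat :=
  match e with
  | WConst k => word k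
  | WVar x => wvar s x
  | WRead a i => warr s a (eval s i)
  | WOp o e1 e2 => word (eval_op o (eval s e1) (eval s e2))
  end.

Fixpoint geval (s : state) (g : group_expr) : A :=
  match g with
  | GZero => 0
  | GVar x => gvar s x
  | GRead a i => garr s a (eval s i)
  | GAdd g1 g2 => geval s g1 + geval s g2
  | GOpp g1 => - geval s g1
  end.

Definition upd (T : Type) (f : nat -> T) (x : nat) (t : T) : nat -> T :=
  fun y => if y == x then t else f y.

Definition set_wvar (s : state) (x v : nat) : state :=
  State (upd (wvar s) x v) (warr s) (gvar s) (garr s) (coins s).

Definition set_warr (s : state) (a i v : nat) : state :=
  State (wvar s) (upd (warr s) a (upd (warr s a) i v))
        (gvar s) (garr s) (coins s).

Definition set_gvar (s : state) (x : nat) (v : A) : state :=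
  State (wvar s) (warr s) (upd (gvar s) x v) (garr s) (coins s).

Definition set_garr (s : state) (a i : nat) (v : A) : state :=
  State (wvar s) (warr s) (gvar s)
        (upd (garr s) a (upd (garr s a) i v)) (coins s).

Definition flip (s : state) (x : nat) : state :=
  State (upd (wvar s) x (word (head false (coins s))))
        (warr s) (gvar s) (garr s) (behead (coins s)).

(* A configuration is the list of commands still to be executed together with
   the current state; the machine has halted when that list is empty. *)
Definition config : Type := (seq cmd * state)%type.

(* One time unit.  An expression is evaluated in one time unit: its size is a
   constant of the program, so that this affects running times by a constant
   factor only. *)
Definition step (cf : config) : config :=
  let: (k, s) := cf in
  match k with
  | [::] => ([::], s)
  | c :: k' =>
    match c with
    | Skip => (k', s)
    | Seq c1 c2 => (c1 :: c2 :: k', s)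
    | If e c1 c2 => ((if eval s e != 0%N then c1 else c2) :: k', s)
    | While e c1 => (if eval s e != 0%N then c1 :: k else k', s)
    | WAssign x e => (k', set_wvar s x (eval s e))
    | WWrite a i e => (k', set_warr s a (eval s i) (eval s e))
    | Flip x => (k', flip s x)
    | GAssign x g => (k', set_gvar s x (geval s g))
    | GWrite a i g => (k', set_garr s a (eval s i) (geval s g))
    end
  end.

Definition halted (cf : config) : bool := nilp cf.1.

End Semantics.

(* An n-vertex input is processed with words of
   [word_factor * (floor (log2 n) + 1)] bits, that is, of O(log n) bits. *)
Record algorithm := Algorithm { word_factor : nat; code : cmd }.

Definition word_size (alg : algorithm) (n : nat) : nat :=
  (word_factor alg * (trunc_log 2 n).+1)%N.

(* Row-major storage of an n x n matrix, padded with d. *)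
Definition flat (T : Type) (d : T) (n : nat) (M : 'M[T]_n) (p : nat) : T :=
  match insub (p %/ n)%N : option 'I_n, insub (p %% n)%N : option 'I_n with
  | Some i, Some j => M i j
  | _, _ => d
  end.

(* n is in word variable 0, M in word array 0, N in group array 0; everything
   else is initially 0. *)
Definition initial_state (A : zmodType) (w n : nat) (M : 'M[bool]_n)
    (N : 'M[A]_n) (tosses : seq bool) : state A :=
  State (upd (fun=> 0%N) 0%N (word w n))
        (upd (fun=> fun=> 0%N) 0%N (fun p => word w (flat false M p)))
        (fun=> 0)
        (upd (fun=> fun=> 0) 0%N (flat 0 N))
        tosses.

(* The result is read in row-major order from group array 1. *)
Definition outputs (A : zmodType) (n : nat) (s : state A) (P : 'M[A]_n) : bool :=
  [forall i : 'I_n, forall j : 'I_n, garr s 1%N (i * n + j)%N == P i j].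

Definition computes_within (A : zmodType) (alg : algorithm) (n : nat)
    (M : 'M[bool]_n) (N P : 'M[A]_n) (t : nat) (tosses : seq bool) : bool :=
  let w := word_size alg n in
  let cf := iter t (step w) ([:: code alg], initial_state w M N tosses) in
  halted cf && outputs cf.2 P.

(* Probability, over independent fair coin tosses, that P is computed from M
   and N within t time units.  Since t time units use at most t coin tosses,
   it suffices to draw t of them uniformly. *)
Definition prob_computes_within (R : realType) (A : zmodType) (alg : algorithm)
    (n : nat) (M : 'M[bool]_n) (N P : 'M[A]_n) (t : nat) : R :=
  #|[set tosses : t.-tuple bool | computes_within alg M N P t tosses]|%:R
    / 2 ^+ t.

(* Main.v *)
Require Import Defs.
From mathcomp Require Import all_boot all_order all_algebra.
From mathcomp Require Import zify ring lra.

Set Implicit Arguments.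
Unset Strict Implicit.
Unset Printing Implicit Defensive.

Import Order.TTheory GRing.Theory Num.Theory.

(** Rows of a bounded twin-width adjacency matrix with pairwise distinct traces
  on a set of columns X number at most O(|X|): when a contraction sequence first
  identifies two columns of X, only O(1) of these rows distinguish them, so
  one of the two columns can be dropped.

  The algorithm keeps a set Y of rows and a set X of columns.  In each of
  O(log n) phases it draws a random column out of every block of K columns of
  X and identifies the rows of Y that agree on this sample T.  By the bound
  above O(|X| / K) rows survive, and with high probability identified rows
  differ on O(log n) columns of X only, since a pair that differs on more of
  them is separated by T.  A row y identified with q is eliminated through
  M_y N = M_q N + sum over the columns x on which they differ of +- N_x.  Then
  the columns of X that are equal on the surviving rows are identified, by
  adding up the corresponding rows of N; again O(|X| / K) columns remain,
  which is at most |X| / 2 up to a constant.  After the last phase X has O(1)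
  elements, and O(n log n) additions of rows of length n have been made.  The
  result is always correct; only the running time is random. *)

(** * Neighbourhood complexity *)

(** No contraction sequence is ever computed: the program only reads [M], and twin-width enters
    solely through the linear bound on distinct traces. Since [M] is symmetric, one bound serves
    rows and columns; using it twice per phase costs a factor [c * c], whence the block size
    [2 ^ j >= 2 * (c * c)]. The algorithm is fixed before the exponent of the failure probability,
    so [j] depends on the twin-width bound only. The exponent enters the analysis alone, through the
    threshold [deviation]. The obstacle to elimination is that row [q] of the product is unknown
    when [y] is eliminated against it, and [q] may be eliminated later. Hence a phase merely records
    instructions and the pair [(y, q)]; the missing additions are made backwards at the end.
    Recording is pure word computation, O(n^2) per phase, and the recorded program is finally run on
    rows of length n. An amortised count bounds its length. In later phases X depends on earlier
    coins. Each phase therefore uses fresh coins, and its failure bound is uniform in the state it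
    starts from. *)

Section TwinWidth.
Variables (V : finType) (e : rel V).

(** [phi] sends a vertex to its part in the current trigraph. Red is always permitted, so the
    content is that a non-red pair of distinct parts is complete or empty; nothing is asserted
    inside a part. *)
Definition homogeneous (G : trigraph) (phi : V -> G) : Prop :=
  forall y x, phi y != phi x ->
    tcol (phi y) (phi x) = (if e y x then Black else NoEdge)
    \/ tcol (phi y) (phi x) = Red.

Definition separated (X Y : {set V}) : Prop :=
  {in Y &, forall y y', {in X, forall x, e y x = e y' x} -> y = y'}.

Definition shatter_const (d : nat) : nat := d.+1 * 2 ^ d.+2.

(** [insub] is the quotient map of the contraction: exactly [u] and [v] go to the new vertex [None].
    A merged colour is red or equals both colours it came from, so it inherits their meaning. *)
Lemma homogeneous_contract (G : trigraph) (phi : V -> G) (u v : G) :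
  homogeneous phi -> @homogeneous (Defs.contract u v) (fun x => insub (phi x)).
Proof.
move=> hom y x.
have inN (z : G) : ~~ ((z != u) && (z != v)) -> z = u \/ z = v.
  by rewrite negb_and !negbK => /orP[] /eqP ->; [left|right].
have merge (a b : colour) :
    merge_col a b = Red \/ (merge_col a b = a /\ merge_col a b = b).
  by case: a b => [] []; do ?[by left]; right.
case: insubP => [y' hy vy|/inN hy]; case: insubP => [x' hx vx|/inN hx] //=.
- move=> ne; rewrite vx vy; apply: hom; rewrite -vx -vy.
  by apply: contraNN ne => /eqP/val_inj ->.
- move=> _; case: (merge (tcol u (val y')) (tcol v (val y'))) => [->|[e1 e2]].
    by right.
  have ne : phi y != phi x.
    rewrite -vy; apply/eqP => E.
    by move: (valP y'); rewrite E; case: hx => ->; rewrite eqxx ?andbF.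
  move: (hom _ _ ne); rewrite tcol_sym -vy.
  by case: hx => ->; [rewrite e1|rewrite e2].
- move=> _; case: (merge (tcol u (val x')) (tcol v (val x'))) => [->|[e1 e2]].
    by right.
  have ne : phi y != phi x.
    rewrite -vx; apply/eqP => E.
    by move: (valP x'); rewrite -E; case: hy => ->; rewrite eqxx ?andbF.
  move: (hom _ _ ne); rewrite -vx.
  by case: hy => ->; [rewrite e1|rewrite e2].
Qed.

(* Consider the first contraction that identifies two elements x1 and x2 of X.
   At that time every part meets X in at most two elements, hence sees at most
   d + 2 elements of X through red edges, hence contains at most 2 ^ (d + 2)
   elements of Y; and only the d + 1 parts in the closed red neighbourhood of
   the part of x1 and x2 can distinguish x1 from x2. *)
Lemma close_pair (d : nat) (G : trigraph) :
  contraction_sequence d G ->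
  forall (phi : V -> G) (X : {set V}),
    homogeneous phi -> {in X &, injective phi} -> 1 < #|X| ->
  exists x1 x2, [/\ x1 \in X, x2 \in X, x1 != x2 &
    forall Y, separated X Y ->
      #|[set y in Y | e y x1 != e y x2]| <= shatter_const d].
Proof.
elim=> {G} [G leG1|G u v neq_uv red_le _ IH] phi X hom inj gtX1.
  suff : #|X| <= 1 by rewrite leqNgt gtX1.
  by rewrite -(card_in_imset inj) (leq_trans (max_card _)).
pose psi (x : V) : Defs.contract u v := insub (phi x).
have homp : @homogeneous (Defs.contract u v) psi by exact: homogeneous_contract.
have [/dinjectiveP injp|] := boolP (dinjectiveb psi (mem X)).
  exact: (IH psi).
case/dinjectivePn => x1 X1 [x2]; rewrite !inE => /andP[ne12 X2] E12.
have phiN x : psi x = None -> phi x = u \/ phi x = v.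
  rewrite /psi; case: insubP => // + _.
  by rewrite negb_and !negbK => /orP[] /eqP ->; [left|right].
have psiN x x' : x \in X -> x' \in X -> x != x' -> psi x = psi x' -> psi x = None.
  move=> hx hx' /negP ne; rewrite /psi.
  case: (insubP _ (phi x)) => // a _ va; case: (insubP _ (phi x')) => // b _ vb.
  by case=> ab; case: ne; apply/eqP/inj; rewrite // -va -vb ab.
have p1 : psi x1 = None by apply: (psiN x1 x2) => //; rewrite eq_sym.
have p2 : psi x2 = None by rewrite -E12.
exists x1, x2; split=> //; first by rewrite eq_sym.
move=> Y sepY.
(* A collision under [psi] can only happen at [None]. Two colliding elements other than [x1] would
   form with [x1] three elements of X sent by [phi] into the pair [u], [v], against injectivity. *)
have injX : {in X :\ x1 &, injective psi}.
  move=> x x'; rewrite !inE => /andP[n1 hx] /andP[n1' hx'] E.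
  apply/eqP/negPn/negP => ne.
  have xN := psiN _ _ hx hx' ne E; have xN' : psi x' = None by rewrite -E.
  have neq a b : a \in X -> b \in X -> a != b -> phi a <> phi b.
    by move=> ha hb /eqP nab /inj; apply: contra_not nab; apply.
  move: (neq _ _ hx hx' ne) (neq _ _ hx X1 n1) (neq _ _ hx' X1 n1').
  by case: (phiN _ xN) => ->; case: (phiN _ xN') => ->; case: (phiN _ p1) => ->.
pose cl (P : Defs.contract u v) := P |: [set Q | is_red (tcol P Q)].
have cl_le P : #|cl P| <= d.+1.
  rewrite cardsU1 -add1n; apply: leq_add; last exact: red_le.
  by case: (_ \notin _).
have part_le P : #|[set y in Y | psi y == P]| <= 2 ^ d.+2.
  pose XP := [set x in X | psi x \in cl P].
  (* [d + 1] elements by injectivity of [psi] away from [x1], plus possibly [x1] itself. *)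
  have XP_le : #|XP| <= d.+2.
    rewrite (cardsD1 x1) -add1n; apply: leq_add; first by case: (_ \in _).
    rewrite -(card_in_imset (f := psi)); last first.
      move=> x x'; rewrite !inE => /and3P[n hx _] /and3P[n' hx' _].
      by apply: injX; rewrite !inE ?n ?n'.
    apply: leq_trans (cl_le P); apply/subset_leq_card/subsetP => Q.
    by case/imsetP => x; rewrite inE => /andP[_]; rewrite inE => /andP[_] ? ->.
  apply: leq_trans (leq_pexp2l (isT : 0 < 2) XP_le).
  rewrite -card_powerset -(card_in_imset (f := fun y => [set x in XP | e y x])).
    apply/subset_leq_card/subsetP => S /imsetP[y _ ->].
    by rewrite powersetE; apply/subsetP => x; rewrite inE => /andP[].
  move=> y y'; rewrite !inE => /andP[hy /eqP py] /andP[hy' /eqP py'] /setP E.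
  (* Outside [XP] the adjacency to [x] is dictated by the non-red colour between [P] and the part of
     [x], hence is the same for [y] and [y']. *)
  apply: sepY => // x hx; have [xP|xP] := boolP (x \in XP).
    by move: (E x); rewrite inE xP /= inE xP.
  move: xP; rewrite inE hx /= !inE negb_or => /andP[nxP nred].
  have h z : psi z = P -> tcol P (psi x) = (if e z x then Black else NoEdge).
    move=> pz; case: (homp z x) => [||]; rewrite ?pz // 1?eq_sym // => E'.
    by rewrite E' in nred.
  by move: (h y py); rewrite (h y' py'); case: (e y x); case: (e y' x).
set Z := [set y in Y | _].
apply: (@leq_trans (\sum_(P in cl None) #|[set y in Y | psi y == P]|)).
  apply: leq_trans (_ : #|\bigcup_(P in cl None) [set y in Y | psi y == P]| <= _).
    apply/subset_leq_card/subsetP => y; rewrite inE => /andP[hy ne].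
    apply/bigcupP; exists (psi y); last by rewrite inE hy eqxx.
    rewrite !inE; have [//|nyN] := eqVneq (psi y) None.
    have h z : psi z = None ->
        tcol (psi y) None = (if e y z then Black else NoEdge)
        \/ tcol (psi y) None = Red.
      by move=> pz; case: (homp y z); rewrite ?pz //; [left|right].
    rewrite orFb tcol_sym.
    case: (h _ p1) => [E1|-> //]; case: (h _ p2) => [E2|-> //].
    by move: ne E2; rewrite E1; case: (e y x1); case: (e y x2).
  apply: (big_ind2 (fun (S : {set V}) k => #|S| <= k)) => [|S k S' k' h h'|//].
    by rewrite cards0.
  apply: leq_trans (leq_add h h'); rewrite cardsU; exact: leq_subr.
apply: leq_trans (leq_sum _ (fun P _ => part_le P)) _.
by rewrite sum_nat_const leq_mul2r cl_le orbT.
Qed.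

(** Induction on the size of X. Dropping [x1] from X, and from Y the at most [shatter_const d] rows
    that tell [x1] from [x2], leaves a separated pair, because [x2] stands in for [x1] on the
    remaining rows. Every round restarts from the same trigraph and [phi]. *)
Lemma separated_card (d : nat) (G : trigraph) (phi : V -> G) (X Y : {set V}) :
  contraction_sequence d G -> homogeneous phi -> injective phi ->
  separated X Y -> #|Y| <= shatter_const d * #|X| + 1.
Proof.
move=> cs hom inj; move: {2}#|X| (leqnn #|X|) => m.
elim: m X Y => [|m IH] X Y cX sep.
  move: cX; rewrite leqn0 cards_eq0 => /eqP X0.
  suff le1 : #|Y| <= 1 by rewrite (leq_trans le1) // leq_addl.
  apply/card_le1_eqP.
  by move=> y y' hy hy'; apply: sep => // x; rewrite X0 inE.
have [gt1|] := ltnP 1 #|X|; last first.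
  case: (posnP #|X|) => [X0 _|gt0 le1]; first by apply: IH; rewrite ?X0.
  have /eqP/cards1P[x Xx] : #|X| = 1 by apply/eqP; rewrite eqn_leq le1.
  have le2 : #|Y| <= #|{: bool}|.
    rewrite -(card_in_imset (f := fun y => e y x)) ?max_card // => y y' hy hy' E.
    by apply: sep => // x'; rewrite Xx inE => /eqP ->.
  rewrite (leq_trans le2) // card_bool Xx cards1 muln1 addn1 ltnS.
  by rewrite /shatter_const muln_gt0 expn_gt0.
have [x1 [x2 [X1 X2 ne12 close]]] := close_pair cs hom (in2W inj) gt1.
have {}close := close Y sep.
have cX1 : #|X| = #|X :\ x1|.+1 by rewrite (cardsD1 x1) X1.
pose Y0 := [set y in Y | e y x1 == e y x2].
have sep0 : separated (X :\ x1) Y0.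
  move=> y y'; rewrite !inE => /andP[hy /eqP ey] /andP[hy' /eqP ey'] E.
  apply: sep => // x hx; have [->|ne] := eqVneq x x1; last first.
    by apply: E; rewrite !inE ne.
  by rewrite ey ey'; apply: E; rewrite !inE eq_sym ne12.
have := IH _ _ _ sep0; rewrite -ltnS -cX1 => /(_ cX) le0.
have -> : #|Y| = #|Y0| + #|[set y in Y | e y x1 != e y x2]|.
  rewrite -(cardsID Y0 Y); congr (_ + _); apply: eq_card => y; rewrite !inE.
    by case: (y \in Y).
  by case: (y \in Y); rewrite ?andbF //= andbT.
by rewrite cX1; lia.
Qed.

End TwinWidth.

Lemma twin_width_separated (G : graph) (d : nat) (X Y : {set G}) :
  twin_width_le G d -> separated (@edge G) X Y ->
  #|Y| <= shatter_const d * #|X| + 1.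
Proof.
move=> tw; apply: (separated_card (phi := id : G -> black_trigraph G) tw) => //.
by move=> y x _; left; rewrite /= /black_col.
Qed.

(** * Elimination of rows and columns *)

Section Representatives.
Variable M : nat -> nat -> bool.
Implicit Types T Y : seq nat.

Definition agree T (y z : nat) : bool := all (fun t => M y t == M z t) T.

Definition rep T Y (y : nat) : nat := head y [seq z <- Y | agree T y z].

Definition reps T Y : seq nat := [seq y <- Y | rep T Y y == y].

Definition nonreps T Y : seq nat := [seq y <- Y | rep T Y y != y].

Lemma agree_refl T y : agree T y y.
Proof. exact/allP. Qed.

Lemma agree_sym T y z : agree T y z = agree T z y.
Proof. by apply: eq_all => t; rewrite eq_sym. Qed.

Lemma agree_trans T z y x : agree T x y -> agree T y z -> agree T x z.
Proof.
by move=> /allP xy /allP yz; apply/allP => t Tt; rewrite (eqP (xy t Tt)) yz.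
Qed.

Lemma agree_eq T y z : agree T y z -> agree T y =1 agree T z.
Proof.
move=> yz x; apply/idP/idP; apply: agree_trans => //.
by rewrite agree_sym.
Qed.

Lemma head_filter (P : pred nat) Y x0 x1 : has P Y ->
  head x0 [seq z <- Y | P z] = head x1 [seq z <- Y | P z].
Proof. by elim: Y => //= z Y IH; case: (P z) => //= /IH. Qed.

Lemma head_filter_sub (P Q : pred nat) Y x0 : has P Y -> subpred Q P ->
  Q (head x0 [seq z <- Y | P z]) ->
  head x0 [seq z <- Y | Q z] = head x0 [seq z <- Y | P z].
Proof.
move=> hP QP; elim: Y hP => //= z Y IH; case Pz: (P z) => /= hP Qh; first by rewrite Qh.
by case Qz: (Q z); [rewrite (QP z Qz) in Pz | exact: IH].
Qed.

Lemma repP T Y y : y \in Y -> rep T Y y \in Y /\ agree T y (rep T Y y).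
Proof.
move=> Yy; have : rep T Y y \in [seq z <- Y | agree T y z].
  rewrite /rep; case E: [seq z <- Y | agree T y z] => [|z s].
    by have := mem_filter (agree T y) y Y; rewrite E Yy agree_refl.
  exact: mem_head.
by rewrite mem_filter => /andP[].
Qed.

Lemma has_agree T Y y : y \in Y -> has (agree T y) Y.
Proof. by move=> Yy; apply/hasP; exists y; rewrite ?agree_refl. Qed.

Lemma rep_eq T Y y z : y \in Y -> agree T y z -> rep T Y y = rep T Y z.
Proof.
move=> Yy yz; rewrite /rep (eq_filter (agree_eq yz)).
by apply: head_filter; rewrite -(eq_has (agree_eq yz)) has_agree.
Qed.

Lemma eq_rep T Y y z : y \in Y -> z \in Y ->
  (rep T Y y == rep T Y z) = agree T y z.
Proof.
move=> Yy Yz; apply/eqP/idP => [E|]; last exact: rep_eq.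
have [_ ay] := repP T Yy; have [_ az] := repP T Yz.
by apply: agree_trans ay _; rewrite E agree_sym.
Qed.

Lemma rep_in_reps T Y y : y \in Y -> rep T Y y \in reps T Y.
Proof.
move=> Yy; have [Yr ar] := repP T Yy.
by rewrite mem_filter Yr andbT eq_sym; apply/eqP/rep_eq.
Qed.

Lemma reps_agree T Y y z :
  y \in reps T Y -> z \in reps T Y -> agree T y z -> y = z.
Proof.
rewrite !mem_filter => /andP[/eqP ry Yy] /andP[/eqP rz Yz].
by rewrite -(eq_rep T Yy Yz) ry rz => /eqP.
Qed.

Lemma mem_reps T Y : {subset reps T Y <= Y}.
Proof. by move=> y; rewrite mem_filter => /andP[]. Qed.

Lemma perm_reps T Y : perm_eq (reps T Y ++ nonreps T Y) Y.
Proof. by rewrite perm_filterC. Qed.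

Lemma rep_nil Y y : rep [::] Y y = head y Y.
Proof. by rewrite /rep filter_predT. Qed.

(** Entries are Boolean, so one more column splits a class into at most two: the part of the old
    representative is still headed by it, the other by its own first element. Hence one cell per old
    representative suffices to refine all classes in one pass. *)
Lemma rep_rcons T t Y y : y \in Y ->
  rep (rcons T t) Y y =
    if M y t == M (rep T Y y) t then rep T Y y
    else head y [seq z <- Y | (rep T Y z == rep T Y y)
                              && (M z t != M (rep T Y y) t)].
Proof.
move=> Yy; have [Yr ar] := repP T Yy; case: ifPn => E.
  rewrite {1}/rep (@head_filter_sub (agree T y)) //; first exact: has_agree.
    by move=> z; rewrite /agree all_rcons => /andP[].
  by rewrite -/(rep T Y y) /agree all_rcons E.
rewrite {1}/rep; congr head; apply: eq_in_filter => z Yz.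
rewrite eq_rep // [agree T z y]agree_sym /agree all_rcons andbC; congr (_ && _).
by move: E; case: (M y t); case: (M _ t); case: (M z t).
Qed.

End Representatives.

(* The instruction (sg, a, b) subtracts (if sg) or adds the b-th register to
   the a-th one. *)
Definition instr : Type := (bool * nat * nat)%type.

(** [elim] lists, in chronological order, each eliminated row with the row it was eliminated
    against. *)
Record work := Work {
  rows : seq nat;
  cols : seq nat;
  prog : seq instr;
  elim : seq (nat * nat) }.

Section Elimination.
Variables (n : nat) (M : nat -> nat -> bool).
Implicit Types (T X Y : seq nat) (Z : work).

(* Register y < n holds the part of the y-th row of the product computed so
   far, register n + x the sum of the rows of N whose columns of M have been
   identified with the x-th one. *)
Definition elim_row X (y q : nat) : seq instr :=
  [seq (M q x, y, n + x) | x <- X & M y x != M q x] ++ [:: (true, y, q)].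

Definition row_phase T Z : work :=
  Work (reps M T (rows Z)) (cols Z)
    (prog Z ++ flatten [seq elim_row (cols Z) y (rep M T (rows Z) y)
                       | y <- nonreps M T (rows Z)])
    (elim Z ++ [seq (y, rep M T (rows Z) y) | y <- nonreps M T (rows Z)]).

Definition col_phase Z : work :=
  Work (rows Z) (reps M (rows Z) (cols Z))
    (prog Z ++ [seq (false, n + rep M (rows Z) (cols Z) x, n + x)
               | x <- nonreps M (rows Z) (cols Z)])
    (elim Z).

Definition phase T Z : work := col_phase (row_phase T Z).

Definition brute_force X Y : seq instr :=
  flatten [seq [seq (false, y, n + x) | x <- X & M y x] | y <- Y].

Definition back_substitution (E : seq (nat * nat)) : seq instr :=
  [seq (false, p.1, p.2) | p <- rev E].

Definition full_prog Z : seq instr :=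
  prog Z ++ brute_force (cols Z) (rows Z) ++ back_substitution (elim Z).

Definition start : work := Work (iota 0 n) (iota 0 n) [::] [::].

(** An acyclicity condition: read from its end, the list only refers to rows already completed,
    which is what back substitution needs. *)
Fixpoint elim_ok Y (E : seq (nat * nat)) : bool :=
  if E is (y, p) :: E' then
    [&& p \in Y ++ unzip1 E', y \notin Y ++ unzip1 E' & elim_ok Y E']
  else true.

Definition work_ok Z : Prop :=
  [/\ perm_eq (rows Z ++ unzip1 (elim Z)) (iota 0 n), uniq (cols Z),
      {in cols Z, forall x, x < n} & elim_ok (rows Z) (elim Z)].

Lemma work_ok_rows Z : work_ok Z -> uniq (rows Z) /\ {in rows Z, forall y, y < n}.
Proof.
case=> pm _ _ _; split.
  by move: (perm_uniq pm); rewrite cat_uniq iota_uniq => /andP[].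
move=> y Yy; have : y \in iota 0 n by rewrite -(perm_mem pm) mem_cat Yy.
by rewrite mem_iota.
Qed.

Lemma work_ok_start : work_ok start.
Proof. by split; rewrite ?cats0 ?iota_uniq // => x; rewrite mem_iota. Qed.

Lemma elim_ok_cat Y Y' E E' : Y =i Y' ++ unzip1 E' ->
  elim_ok Y E -> elim_ok Y' E' -> elim_ok Y' (E ++ E').
Proof.
move=> eqY; elim: E => //= -[y p] E IH /and3P[hp hy okE] okE'; rewrite IH // andbT.
have mem z : (z \in Y' ++ unzip1 (E ++ E')) = (z \in Y ++ unzip1 E).
  rewrite /unzip1 map_cat !mem_cat eqY mem_cat.
  by case: (z \in Y'); case: (z \in unzip1 E); rewrite ?orbT ?orbF.
by rewrite !mem hp hy.
Qed.

Lemma work_ok_row_phase T Z : work_ok Z -> work_ok (row_phase T Z).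
Proof.
move=> okZ; have [uY ltY] := work_ok_rows okZ; case: okZ => pm uX ltX okE.
set Y := rows Z in uY ltY pm okE *.
have u1 : unzip1 [seq (y, rep M T Y y) | y <- nonreps M T Y] = nonreps M T Y.
  by rewrite /unzip1 -map_comp map_id.
split=> //=; rewrite -/Y.
  apply: perm_trans pm; rewrite /unzip1 map_cat -/(unzip1 (elim Z)).
  rewrite -/(unzip1 [seq (y, rep M T Y y) | y <- _]) u1.
  by rewrite perm_catCA perm_catC perm_cat2r perm_reps.
apply: elim_ok_cat okE _.
  by move=> y; rewrite u1; apply/perm_mem; rewrite perm_sym perm_reps.
have uN : uniq (nonreps M T Y) by rewrite filter_uniq.
have subN : {subset nonreps M T Y <= Y} by move=> y; rewrite mem_filter => /andP[].
have disj : {in nonreps M T Y, forall y, y \notin reps M T Y}.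
  by move=> y; rewrite !mem_filter => /andP[/negPf->].
elim: (nonreps M T Y) uN subN disj => //= y N IH /andP[yN uN] subN disj.
have u1' : unzip1 [seq (y, rep M T Y y) | y <- N] = N.
  by rewrite /unzip1 -map_comp map_id.
rewrite u1' !mem_cat rep_in_reps /=; last by apply: subN; rewrite mem_head.
rewrite negb_or yN disj ?mem_head //= IH // => z Nz.
  by apply: subN; rewrite inE Nz orbT.
by apply: disj; rewrite inE Nz orbT.
Qed.

Lemma work_ok_col_phase Z : work_ok Z -> work_ok (col_phase Z).
Proof.
case=> pm uX ltX okE; split=> //=; first exact: filter_uniq.
by move=> x /mem_reps; apply: ltX.
Qed.

Lemma work_ok_phase T Z : work_ok Z -> work_ok (phase T Z).
Proof. by move=> /(work_ok_row_phase T)/work_ok_col_phase. Qed.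

(** Amortisation: a row that leaves [rows] releases [tau + 1] units, which pay for at most [tau]
    differing columns and the subtraction of its representative; a column that leaves [cols] pays
    for its single addition. *)
Definition potential (tau : nat) Z : nat :=
  size (prog Z) + size (rows Z) * tau.+1 + size (cols Z).

Lemma potential_phase tau T Z :
  {in rows Z, forall y,
    count (fun x => M y x != M (rep M T (rows Z) y) x) (cols Z) <= tau} ->
  potential tau (phase T Z) <= potential tau Z.
Proof.
move=> le_tau; rewrite /potential /phase /col_phase /=.
set Y := rows Z in le_tau *; set Y' := reps M T Y.
rewrite !size_cat size_map.
have sz L L' (T' : seq nat) : L = reps M T' L' -> size L' = size L + size (nonreps M T' L').
  by move=> ->; rewrite -size_cat; apply/esym/perm_size/perm_reps.
rewrite (sz (reps M T Y) Y T erefl) (sz (reps M Y' (cols Z)) (cols Z) Y' erefl).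
have : size (flatten [seq elim_row (cols Z) y (rep M T Y y) | y <- nonreps M T Y])
       <= size (nonreps M T Y) * tau.+1.
  have : {subset nonreps M T Y <= Y} by move=> y; rewrite mem_filter => /andP[].
  elim: (nonreps M T Y) => //= y N IH sub.
  rewrite size_cat mulSn leq_add ?IH //; last first.
    by move=> z Nz; apply: sub; rewrite inE Nz orbT.
  rewrite size_cat size_map size_filter addn1 ltnS le_tau // sub //.
  exact: mem_head.
by rewrite -/Y -/Y'; lia.
Qed.

End Elimination.

(** * Correctness of the recorded instructions over an abelian group *)

Section Execution.
Variables (A : zmodType) (n : nat) (M : nat -> nat -> bool).
Hypothesis M_sym : forall i j, M i j = M j i.
Implicit Types (V : nat -> A) (T X Y : seq nat) (Z : work).
Local Open Scope ring_scope.

Definition exec_instr V (i : instr) : nat -> A :=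
  let: (sg, a, b) := i in upd V a (if sg then V a - V b else V a + V b).

Definition exec V (p : seq instr) : nat -> A := foldl exec_instr V p.

Lemma exec_cat V p q : exec V (p ++ q) = exec (exec V p) q.
Proof. exact: foldl_cat. Qed.

Definition row_sum V X (y : nat) : A := \sum_(x <- X | M y x) V (n + x)%N.

Lemma exec_row (sg : nat -> bool) V X y z : (y < n)%N ->
  exec V [seq (sg x, y, n + x)%N | x <- X] z =
    if z == y then V y + \sum_(x <- X) (if sg x then - V (n + x)%N else V (n + x)%N)
    else V z.
Proof.
move=> lt_yn; elim: X V => [|x X IH] V.
  by rewrite big_nil addr0 /=; case: eqP => [->|].
have ne x' : (n + x' == y)%N = false by apply/negbTE/eqP; lia.
rewrite /= IH /= /upd eqxx; case: eqP => // _.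
rewrite big_cons addrA; congr (_ + _); first by case: (sg x).
by apply: eq_bigr => x' _; rewrite ne.
Qed.

(** Columns on which the two rows agree cancel in the difference of the row sums; on the others
    [M q x] decides the sign. Every source is [q] or a register from [n] on, so writing to [y]
    disturbs none of them. *)
Lemma exec_elim_row V X y q z : (y < n)%N -> y != q ->
  exec V (elim_row n M X y q) z =
    if z == y then (V y + row_sum V X y) - (V q + row_sum V X q) else V z.
Proof.
move=> lt_yn ne_yq; rewrite exec_cat.
rewrite /= /upd !exec_row // eqxx (eq_sym q) (negPf ne_yq).
case: eqP => // _; rewrite opprD addrA [RHS]addrAC; congr (_ - _).
rewrite -addrA; congr (_ + _).
rewrite /row_sum big_filter big_mkcond /= [X in X - _]big_mkcond /=.
rewrite [X in _ - X]big_mkcond /= -sumrB; apply: eq_bigr => x _.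
by case: (M y x); case: (M q x); rewrite /= ?subr0 ?sub0r ?subrr.
Qed.

(** No representative lies in [N], so each is read with the value it had before the batch. *)
Lemma exec_elim_rows V X (r : nat -> nat) (out : nat -> A) N z :
  uniq N -> {in N, forall y, y < n}%N -> {in N, forall y, r y \notin N} ->
  {in N, forall y, out y = V y + row_sum V X y
                   /\ out (r y) = V (r y) + row_sum V X (r y)} ->
  exec V (flatten [seq elim_row n M X y (r y) | y <- N]) z =
    if z \in N then out z - out (r z) else V z.
Proof.
elim: N V => [|y N IH] V //= /andP[yN uN] ltN rN outN.
have [oy or] := outN y (mem_head _ _).
have ne_y : y != r y.
  by have := rN y (mem_head _ _); rewrite inE negb_or eq_sym => /andP[].
have lt_y : (y < n)%N by apply: ltN; rewrite mem_head.
have E z' : exec V (elim_row n M X y (r y)) z' =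
    if z' == y then out y - out (r y) else V z'.
  by rewrite exec_elim_row // -oy -or.
have Erow y' : row_sum (exec V (elim_row n M X y (r y))) X y' = row_sum V X y'.
  by apply: eq_bigr => x _; rewrite E; case: eqP => // H; lia.
rewrite exec_cat IH //; first last.
- move=> y' Ny'; rewrite !E !Erow.
  have Ny'y : y' \in y :: N by rewrite inE Ny' orbT.
  have [oy' or'] := outN y' Ny'y.
  rewrite ifN; last by apply: contraNneq yN => <-.
  rewrite ifN //; apply: contraNneq (rN y' Ny'y) => ->.
  by rewrite mem_head.
- move=> y' Ny'; have := rN y'; rewrite !inE Ny' orbT => /(_ isT).
  by rewrite negb_or => /andP[].
- by move=> y' Ny'; apply: ltN; rewrite inE Ny' orbT.
by rewrite E inE; case: eqP => [->|//]; rewrite (negPf yN).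
Qed.

Lemma exec_merge_cols_lt V (r : nat -> nat) N z : (z < n)%N ->
  exec V [seq (false, n + r x, n + x)%N | x <- N] z = V z.
Proof.
move=> lt_zn; elim: N V => //= x N IH V; rewrite IH /upd.
by case: eqP => // ?; lia.
Qed.

(** Writes go to registers of [R] and reads to those of the disjoint [N], so no sum is counted
    twice. As row [y] does not distinguish [x] from [r x], moving the term of [x] into the register
    of [r x] preserves the total. *)
Lemma exec_merge_cols V R (r : nat -> nat) N y :
  uniq R -> {in N, forall x, r x \in R} -> {in N, forall x, x \notin R} ->
  uniq N -> {in N, forall x, M y (r x) = M y x} ->
  row_sum (exec V [seq (false, n + r x, n + x)%N | x <- N]) R y =
    row_sum V R y + row_sum V N y.
Proof.
move=> uR; elim: N V => [|x N IH] V /= rR NR uN MN.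
  by rewrite /row_sum big_nil addr0.
case/andP: uN => xN uN.
have sub z : z \in N -> z \in x :: N by rewrite inE orbC => ->.
set V1 := upd V _ _.
rewrite IH //; first last.
- by move=> z /sub/MN.
- by move=> z /sub/NR.
- by move=> z /sub/rR.
have -> : row_sum V1 N y = row_sum V N y.
  rewrite /row_sum big_seq_cond [RHS]big_seq_cond; apply: eq_bigr => z /andP[Nz _].
  rewrite /V1 /upd eqn_add2l; case: eqP => // zr.
  by have := NR z (sub z Nz); rewrite zr rR ?mem_head.
have -> : row_sum V (x :: N) y = row_sum V [:: x] y + row_sum V N y.
  by rewrite /row_sum -cat1s big_cat.
rewrite addrA; congr (_ + _).
have Rrx := rR x (mem_head _ _).
rewrite /row_sum big_cons big_nil -(MN x (mem_head _ _)).
rewrite big_mkcond [in RHS]big_mkcond /= (bigD1_seq (r x)) //=.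
rewrite [in RHS](bigD1_seq (r x)) //=.
have -> : \sum_(i <- R | i != r x) (if M y i then V1 (n + i)%N else 0) =
          \sum_(i <- R | i != r x) (if M y i then V (n + i)%N else 0).
  by apply: eq_bigr => i ne; rewrite /V1 /upd eqn_add2l (negPf ne).
rewrite /V1 /upd eqxx; case: (M y _); rewrite ?addr0 //.
by rewrite [RHS]addrAC.
Qed.

(** [out] is the final product. After its elimination the register of a row stays fixed until back
    substitution and holds its deviation from the output of the other row, which may still be
    unknown. *)
Definition computes (out : nat -> A) V Z : Prop :=
  {in rows Z, forall y, out y = V y + row_sum V (cols Z) y}
  /\ {in elim Z, forall p, out p.1 = V p.1 + out p.2}.

Lemma computes_row_phase out V0 T Z : work_ok n Z ->
  computes out (exec V0 (prog Z)) Z ->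
  computes out (exec V0 (prog (row_phase n M T Z))) (row_phase n M T Z).
Proof.
move=> okZ [outY outE]; have [uY ltY] := work_ok_rows okZ.
case: okZ => pm uX ltX okE; rewrite /= exec_cat.
set V := exec V0 (prog Z) in outY outE *.
set Y := rows Z in uY ltY pm okE outY *; set N := nonreps M T Y.
have subN : {subset N <= Y} by move=> y; rewrite mem_filter => /andP[].
have disj y : y \in reps M T Y -> y \notin N.
  by rewrite !mem_filter => /andP[->].
have E z := @exec_elim_rows V (cols Z) (rep M T Y) out N z.
set V' := exec V _ in E *.
have {}E z : V' z = if z \in N then out z - out (rep M T Y z) else V z.
  apply: E; first exact: filter_uniq.
  - by move=> y /subN/ltY.
  - by move=> y /subN Yy; apply/disj/rep_in_reps.
  - move=> y /subN Yy; split; first exact: outY.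
    by apply: outY; have [] := repP M T Yy.
have Erow y : row_sum V' (cols Z) y = row_sum V (cols Z) y.
  apply: eq_bigr => x _; rewrite E ifN //; apply/negP => /subN/ltY.
  by lia.
split=> /= [y Yy|p].
  by rewrite Erow E (negPf (disj y Yy)); apply/outY/(mem_reps Yy).
rewrite mem_cat => /orP[Ep|/mapP[y Ny ->] /=]; last first.
  by rewrite E Ny subrK.
rewrite E ifN; first exact: outE.
apply/negP => /subN Yp; move: (perm_uniq pm); rewrite iota_uniq cat_uniq.
move=> /and3P[_ /hasPn/(_ p.1) + _]; rewrite -/Y => /(_ (map_f _ Ep)).
by rewrite /= Yp.
Qed.

Lemma computes_col_phase out V0 Z : work_ok n Z ->
  computes out (exec V0 (prog Z)) Z ->
  computes out (exec V0 (prog (col_phase n M Z))) (col_phase n M Z).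
Proof.
move=> okZ [outY outE]; have [uY ltY] := work_ok_rows okZ.
case: okZ => pm uX ltX okE; rewrite /= exec_cat.
set V := exec V0 (prog Z) in outY outE *.
set X := cols Z in uX ltX outY *; set N := nonreps M (rows Z) X.
set R := reps M (rows Z) X.
have subN : {subset N <= X} by move=> y; rewrite mem_filter => /andP[].
set V' := exec V _.
have lt_V' z : (z < n)%N -> V' z = V z by exact: exec_merge_cols_lt.
split=> /= [y Yy|p Ep].
  rewrite lt_V' ?ltY // exec_merge_cols ?filter_uniq //.
  - rewrite [row_sum V R y + _](_ : _ = row_sum V X y); first exact: outY.
    by rewrite /row_sum -big_cat; apply: perm_big; rewrite perm_reps.
  - by move=> x /subN Xx; apply: rep_in_reps.
  - by move=> x; rewrite !mem_filter => /andP[/negPf->].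
  (* Columns were compared through the entries [M x y], as if they were rows; symmetry turns this
     into equality within row [y]. *)
  - move=> x /subN Xx; have [_ /allP/(_ y Yy)/eqP] := repP M (rows Z) Xx.
    by rewrite (M_sym x) (M_sym (rep _ _ _ _)) => ->.
rewrite lt_V'; first exact: outE.
have : p.1 \in iota 0 n by rewrite -(perm_mem pm) mem_cat map_f ?orbT.
by rewrite mem_iota.
Qed.

Lemma computes_phase out V0 T Z : work_ok n Z ->
  computes out (exec V0 (prog Z)) Z ->
  computes out (exec V0 (prog (phase n M T Z))) (phase n M T Z).
Proof.
move=> okZ cZ; apply: computes_col_phase; first exact: work_ok_row_phase.
exact: computes_row_phase.
Qed.

Lemma exec_brute_force V X Y z : uniq Y -> {in Y, forall y, y < n}%N ->
  exec V (brute_force n M X Y) z =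
    if z \in Y then V z + row_sum V X z else V z.
Proof.
elim: Y V => [|y Y IH] V //= /andP[yY uY] ltY.
have lt_y : (y < n)%N by apply: ltY; rewrite mem_head.
have E z' : exec V [seq (false, y, n + x)%N | x <- [seq x <- X | M y x]] z' =
    if z' == y then V y + row_sum V X y else V z'.
  by rewrite (exec_row (fun=> false)) // /row_sum big_filter.
rewrite /brute_force /= exec_cat -/(brute_force n M X Y) IH //; last first.
  by move=> y' Yy'; apply: ltY; rewrite inE Yy' orbT.
rewrite !E inE; have [->|ne] := eqVneq z y; first by rewrite (negPf yY).
case: ifP => // Yz; congr (_ + _); apply: eq_bigr => x _.
by rewrite E; case: eqP => // ?; lia.
Qed.

(** The head of [E] is processed last. By then everything in [Y ++ unzip1 E] for the tail is final,
    in particular [p], while [y] is untouched; the second conjunct carries the latter through the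
    induction. *)
Lemma exec_back_substitution (out : nat -> A) V Y E :
  elim_ok Y E -> {in Y, forall y, V y = out y} ->
  {in E, forall p, out p.1 = V p.1 + out p.2} ->
  let V' := exec V (back_substitution E) in
  {in Y ++ unzip1 E, forall y, V' y = out y}
  /\ forall y, y \notin unzip1 E -> V' y = V y.
Proof.
elim: E => [|[y p] E IH] /=; first by rewrite cats0.
case/and3P=> hp hy okE VY outE.
have [|V1 V2] := IH okE VY.
  by move=> q Eq; apply: outE; rewrite inE Eq orbT.
rewrite /back_substitution rev_cons map_rcons -cats1 exec_cat.
rewrite -/(back_substitution E) /= /upd.
move: hy; rewrite mem_cat negb_or => /andP[yY yE]; split=> z.
  rewrite mem_cat inE; case: eqP => [->|ne].
    by rewrite (V1 p) // V2 // (outE (y, p)) // mem_head.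
  by rewrite /= => h; rewrite V1 // mem_cat.
by rewrite inE negb_or => /andP[/negPf-> /V2].
Qed.

Lemma exec_full_prog out V0 Z y : work_ok n Z ->
  computes out (exec V0 (prog Z)) Z -> (y < n)%N ->
  exec V0 (full_prog n M Z) y = out y.
Proof.
move=> okZ [outY outE] lt_yn; have [uY ltY] := work_ok_rows okZ.
case: okZ => pm uX ltX okE; rewrite /full_prog !exec_cat.
set V := exec V0 (prog Z) in outY outE *.
have E z := exec_brute_force V (cols Z) z uY ltY.
set V1 := exec V (brute_force _ _ _ _) in E *.
have [||h _] := @exec_back_substitution out V1 (rows Z) (elim Z) okE.
- by move=> z Yz; rewrite E Yz -outY.
- move=> p Ep; rewrite E ifN; first exact: outE.
  apply/negP => Yp; move: (perm_uniq pm); rewrite iota_uniq cat_uniq.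
  move=> /and3P[_ /hasPn/(_ p.1) + _] => /(_ (map_f _ Ep)).
  by rewrite /= Yp.
by apply: h; rewrite (perm_mem pm) mem_iota.
Qed.

Lemma computes_start out V0 :
  (forall y, (y < n)%N -> out y = V0 y + row_sum V0 (iota 0 n) y) ->
  computes out V0 (start n).
Proof. by move=> h; split=> //= y; rewrite mem_iota => /h. Qed.

End Execution.

(** * Random sampling *)

Section Sampling.
Variable j : nat.
Implicit Types (X : seq nat) (cs : seq bool).

(** Horner evaluation of [m] coins, most significant first, with accumulator [r]. Missing coins
    count as [false], as for [flip]. *)
Fixpoint bits_val (m r : nat) cs : nat :=
  if m is m'.+1 then bits_val m' (2 * r + head false cs) (behead cs) else r.

Lemma bits_val_cat m r cs cs' : m <= size cs ->
  bits_val m r (cs ++ cs') = bits_val m r cs.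
Proof. by elim: m r cs => //= m IH r [|b cs] //= /IH. Qed.

Lemma bits_val_lt m r cs : bits_val m r cs < r.+1 * 2 ^ m.
Proof.
elim: m r cs => [|m IH] r cs /=; first by rewrite muln1.
apply: leq_trans (IH _ _) _; rewrite expnS mulnA leq_mul2r.
by case: (head false cs); rewrite orbC; apply/orP; left; lia.
Qed.

Definition draw cs (g : nat) : nat := g * 2 ^ j + bits_val j 0 (drop (g * j) cs).

(* One element of each of the first G blocks of 2 ^ j consecutive elements of
   X, chosen by j coin tosses; a choice beyond the end of X is dropped. *)
Definition sample X cs (G : nat) : seq nat :=
  [seq nth 0 X (draw cs g) | g <- iota 0 G & draw cs g < size X].

Lemma sampleS X cs G :
  sample X cs G.+1 =
    (if bits_val j 0 cs < size X then [:: nth 0 X (bits_val j 0 cs)] else [::])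
    ++ sample (drop (2 ^ j) X) (drop j cs) G.
Proof.
have E : [seq nth 0 X (draw cs g) | g <- iota 1 G & draw cs g < size X] =
         sample (drop (2 ^ j) X) (drop j cs) G.
  rewrite -[1]addn0 iotaDl filter_map -map_comp /sample.
  have dE g : draw cs g.+1 = 2 ^ j + draw (drop j cs) g.
    by rewrite /draw drop_drop mulSn mulSn addnA [g * j + j]addnC.
  rewrite (@eq_filter _ _ (fun g => draw (drop j cs) g < size (drop (2 ^ j) X))).
    by apply: eq_map => g /=; rewrite add1n dE nth_drop.
  by move=> g /=; rewrite add1n dE size_drop ltn_subRL.
rewrite -E {1}/sample /=.
have d0 : draw cs 0 = bits_val j 0 cs by rewrite /draw !mul0n drop0.
by rewrite d0; case: ifP => //= _; rewrite d0.
Qed.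

Lemma sample_sub X cs G : {subset sample X cs G <= X}.
Proof.
by move=> x /mapP[g]; rewrite mem_filter => /andP[lt _] ->; apply: mem_nth.
Qed.

Lemma sample_nil cs G : sample [::] cs G = [::].
Proof. by rewrite /sample (@eq_filter _ _ pred0) ?filter_pred0. Qed.

(** Only blocks that meet X contribute, with one element at most; the summand [2 ^ j] accounts for
    an incomplete last block. *)
Lemma size_sample X cs G : 2 ^ j * size (sample X cs G) <= size X + 2 ^ j.
Proof.
elim: G X cs => [|G IH] X cs; first by rewrite muln0.
rewrite sampleS size_cat; have := IH (drop (2 ^ j) X) (drop j cs).
case: X => [|x X']; first by rewrite /= sample_nil muln0.
rewrite size_drop; set s := size (sample _ _ _); set k := 2 ^ j.
have : size (if bits_val j 0 cs < size (x :: X') then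
   [:: nth 0 (x :: X') (bits_val j 0 cs)] else [::]) <= 1 by case: ifP.
set a := size (if _ then _ else _) => a1 le.
have [lt|ge] := leqP k (size (x :: X')).
  by rewrite mulnDr; nia.
have s0 : s = 0.
  by rewrite /s drop_oversize ?sample_nil // ltnW.
by rewrite s0 addn0; nia.
Qed.

Lemma sample_cat X cs cs' G : G * j <= size cs ->
  sample X (cs ++ cs') G = sample X cs G.
Proof.
move=> szcs; rewrite /sample.
have E : {in iota 0 G, draw (cs ++ cs') =1 draw cs}.
  move=> g; rewrite mem_iota /= add0n => lt_g; rewrite /draw drop_cat.
  have [lt|ge] := ltnP; last first.
    (* Here [G * j <= size cs <= g * j] with [g < G], which forces [j = 0], and no coin is read. *)
    by have -> : j = 0 by nia.
  by rewrite bits_val_cat // size_drop; nia.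
rewrite (eq_in_filter (a2 := fun g => draw cs g < size X)); last first.
  by move=> g /E ->.
by apply/eq_in_map => g; rewrite mem_filter => /andP[_ /E ->].
Qed.

End Sampling.

(** * Expectation over coin tosses and the probability of missing a set *)

Section Average.
Variable R : realFieldType.
Implicit Types f g : seq bool -> R.
Local Open Scope ring_scope.

(** Expectation over [t] fair coins. The recursion makes conditioning on a prefix immediate
    ([avg_add]); [avg_card] links it to counting tuples. *)
Fixpoint avg (t : nat) f : R :=
  if t is t'.+1 then
    (avg t' (fun cs => f (true :: cs)) + avg t' (fun cs => f (false :: cs))) / 2
  else f [::].

Lemma avg_le t f g : (forall cs, size cs = t -> f cs <= g cs) -> avg t f <= avg t g.
Proof.
elim: t f g => [|t IH] f g le /=; first exact: le.
rewrite ler_pM2r ?invr_gt0 ?ltr0n // lerD // IH // => cs szcs;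
  by apply: le; rewrite /= szcs.
Qed.

Lemma eq_avg t f g : (forall cs, size cs = t -> f cs = g cs) -> avg t f = avg t g.
Proof. by move=> E; apply/le_anti; rewrite !avg_le // => cs /E ->. Qed.

Lemma avgD t f g : avg t (fun cs => f cs + g cs) = avg t f + avg t g.
Proof. by elim: t f g => //= t IH f g; rewrite !IH; ring. Qed.

Lemma avgZ t (a : R) f : avg t (fun cs => a * f cs) = a * avg t f.
Proof. by elim: t f => //= t IH f; rewrite !IH; ring. Qed.

Lemma avg_const t (a : R) : avg t (fun=> a) = a.
Proof. by elim: t => //= t ->; field. Qed.

Lemma avg_sum t (I : Type) (r : seq I) (F : I -> seq bool -> R) :
  avg t (fun cs => \sum_(i <- r) F i cs) = \sum_(i <- r) avg t (F i).
Proof.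
elim: r => [|i r IH].
  by rewrite big_nil -[RHS](avg_const t); apply: eq_avg => cs _; rewrite big_nil.
by rewrite big_cons -IH -avgD; apply: eq_avg => cs _; rewrite big_cons.
Qed.

Lemma avg_add s t f : avg (s + t) f = avg s (fun u => avg t (fun v => f (u ++ v))).
Proof. by elim: s f => //= s IH f; rewrite !IH. Qed.

Lemma avg_card t (P : pred (seq bool)) :
  avg t (fun cs => (P cs)%:R) = #|[set u : t.-tuple bool | P u]|%:R / 2 ^+ t.
Proof.
elim: t P => [|t IH] P /=.
  rewrite expr0 divr1; congr (_%:R).
  have E (u : 0.-tuple bool) : u = [tuple] by apply/val_inj; case: u => [[]].
  case h : (P [::]).
    apply/esym/eqP/cards1P; exists [tuple]; apply/setP => u.
    by rewrite !inE (E u) /= h eqxx.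
  by apply/esym/eqP; rewrite cards_eq0 -subset0; apply/subsetP => u; rewrite inE (E u) /= h.
rewrite !IH -mulrDl -natrD exprS invfM [2^-1 * _]mulrC mulrA.
congr (_%:R / _ / _).
have inj b : injective (fun u : t.-tuple bool => [tuple of b :: u]).
  by move=> u v /(congr1 val) /= [] /val_inj.
rewrite -(card_imset _ (inj true)) -(card_imset _ (inj false)) -cardsUI.
rewrite [X in (_ + X)%N](_ : _ = 0%N) ?addn0; last first.
  apply/eqP; rewrite cards_eq0 -subset0; apply/subsetP => u; rewrite inE.
  by case/andP => /imsetP[v _ ->] /imsetP[v' _ /(congr1 val)].
apply: eq_card => u; rewrite !inE; apply/idP/idP.
  by case/orP => /imsetP[v + ->]; rewrite inE.
case/tupleP: u => b u Pu; apply/orP.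
by case: b Pu => Pu; [left|right]; apply/imsetP; exists u; rewrite ?inE.
Qed.

(** [j] coins read as a number are uniform and independent of the coins that follow. The general
    accumulator is for the induction. *)
Lemma avg_bits j t r (F : nat -> seq bool -> R) :
  avg (j + t) (fun cs => F (bits_val j r cs) (drop j cs)) =
  (2 ^+ j)^-1 * \sum_(0 <= v < (2 ^ j)%N) avg t (F (r * 2 ^ j + v)%N).
Proof.
elim: j r => [|j IH] r.
  rewrite expn0 big_nat1 muln1 addn0 expr0 invr1 mul1r.
  by apply: eq_avg => cs _; rewrite drop0.
rewrite /= !IH -mulrDr exprS invfM mulrC mulrA [2^-1 * _]mulrC -!mulrA.
congr (_ * (_ * _)).
have -> : (2 ^ j.+1 = 2 ^ j + 2 ^ j)%N by rewrite expnS mul2n addnn.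
rewrite [RHS](big_cat_nat (n := (2 ^ j)%N)) ?leq_addl //=.
rewrite [X in _ = _ + X](_ : _ = \sum_(0 <= v < (2 ^ j)%N)
    avg t (F (r * (2 ^ j + 2 ^ j) + (v + 2 ^ j))%N)); last first.
  by rewrite -[X in \sum_(X <= _ < _) _]add0n big_addn addnK.
rewrite addrC; congr (_ + _).
  by apply: eq_bigr => v _; congr (avg _ (F _)); rewrite /=; lia.
by apply: eq_bigr => v _; congr (avg _ (F _)); rewrite /=; lia.
Qed.

Lemma bernoulli (a : R) m : 0 <= a <= 1 -> 1 - m%:R * a <= (1 - a) ^+ m.
Proof.
case/andP=> a0 a1; elim: m => [|m IH]; first by rewrite expr0 mul0r subr0.
rewrite exprS; have h : 0 <= m%:R :> R by rewrite ler0n.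
have : (1 - a) * (1 - m%:R * a) <= (1 - a) * (1 - a) ^+ m.
  by apply: ler_wpM2l => //; lra.
by rewrite -[m.+1%:R]natr1; apply: le_trans; nra.
Qed.

(** [(1 + 1/K) ^ K >= 2], and its product with [(1 - 1/K) ^ K] is a power of [1 - 1/K ^ 2], hence at
    most 1. *)
Lemma bernoulli_half (K : nat) : (0 < K)%N -> (1 - K%:R^-1 : R) ^+ K <= 2^-1.
Proof.
move=> K0; have K0' : (0 : R) < K%:R by rewrite ltr0n.
have K1 : (K%:R^-1 : R) <= 1 by rewrite invf_le1 // ler1n.
have Ki : (0 : R) < K%:R^-1 by rewrite invr_gt0.
have h m : 1 + m%:R * K%:R^-1 <= (1 + K%:R^-1 : R) ^+ m.
  elim: m => [|m IH]; first by rewrite expr0 mul0r addr0.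
  rewrite exprS; have hm : 0 <= m%:R :> R by rewrite ler0n.
  have : (1 + K%:R^-1) * (1 + m%:R * K%:R^-1) <= (1 + K%:R^-1 : R) * (1 + K%:R^-1) ^+ m.
    by apply: ler_wpM2l => //; lra.
  by rewrite -[m.+1%:R]natr1; apply: le_trans; nra.
have := h K; rewrite mulfV ?gt_eqF // => h2.
have le1 : (1 - K%:R^-1 : R) ^+ K * (1 + K%:R^-1) ^+ K <= 1.
  by rewrite -exprMn; apply: exprn_ile1; nra.
have h0 : 0 <= (1 - K%:R^-1 : R) ^+ K by rewrite exprn_ge0 // subr_ge0.
have hp : (0 : R) < 2 by rewrite ltr0n.
rewrite -[2^-1]mul1r ler_pdivlMr //; apply: le_trans le1.
by apply: ler_wpM2l.
Qed.

Lemma sum_hits (D : pred nat) X K :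
  \sum_(0 <= v < K) ((v < size X)%N && D (nth 0%N X v))%:R = (count D (take K X))%:R :> R.
Proof.
elim: K X => [|K IH] X; first by rewrite big_nil take0.
case: X => [|x X].
  by rewrite big1_seq //= => v _; rewrite ltn0.
by rewrite big_nat_recl //= IH natrD.
Qed.

(** A block with [d] elements of [D] is missed with probability [1 - d / 2 ^ j], at most
    [(1 - 1 / 2 ^ j) ^ d] by [bernoulli]. Blocks use disjoint coins, so the factors multiply and the
    exponents add up to the count over X, which the blocks cover by hypothesis. *)
Lemma avg_miss j (D : pred nat) X G : (size X <= G * 2 ^ j)%N ->
  avg (G * j) (fun cs => (~~ has D (sample j X cs G))%:R) <=
  (1 - (2 ^ j)%:R^-1) ^+ count D X.
Proof.
set p : R := 1 - _.
have K0 : (0 : R) < (2 ^ j)%:R by rewrite ltr0n expn_gt0.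
have K1 : ((2 ^ j)%:R^-1 : R) <= 1 by rewrite invf_le1 // ler1n expn_gt0.
have Ki : (0 : R) < (2 ^ j)%:R^-1 by rewrite invr_gt0.
elim: G X => [|G IH] X.
  by rewrite mul0n leqn0 size_eq0 => /eqP -> /=; rewrite expr0.
move=> le; pose h v := (v < size X)%N && D (nth 0%N X v).
pose F v cs : R := (~~ h v)%:R * (~~ has D (sample j (drop (2 ^ j) X) cs G))%:R.
rewrite mulSn (@eq_avg _ _ (fun cs => F (bits_val j 0 cs) (drop j cs))); last first.
  move=> cs _; rewrite sampleS has_cat negb_or /F /h -natrM mulnb; congr (_%:R).
  by case: ifP => //=; rewrite orbF.
rewrite avg_bits.
have le' : (size (drop (2 ^ j) X) <= G * 2 ^ j)%N by rewrite size_drop leq_subLR -mulSn.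
have {}IH := IH _ le'; rewrite -natrX.
set c := avg _ _ in IH.
have -> : \sum_(0 <= v < (2 ^ j)%N) avg (G * j) (F (0 * 2 ^ j + v)%N) =
          (\sum_(0 <= v < (2 ^ j)%N) (~~ h v)%:R) * c.
  by rewrite mulr_suml; apply: eq_bigr => v _; rewrite mul0n add0n /F avgZ.
have -> : \sum_(0 <= v < (2 ^ j)%N) (~~ h v)%:R =
          (2 ^ j)%:R - (count D (take (2 ^ j) X))%:R :> R.
  rewrite -sum_hits -[(2 ^ j)%:R](_ : \sum_(0 <= v < (2 ^ j)%N) (1 : R) = _).
    rewrite -sumrB; apply: eq_bigr => v _; rewrite -/(h v).
    by case: (h v); rewrite ?subrr ?subr0.
  by rewrite sumr_const_nat subn0.
rewrite mulrA mulrBr mulVf ?gt_eqF //.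
rewrite -{2}(cat_take_drop (2 ^ j) X) count_cat exprD.
set d := count D (take _ _).
have dK : (d <= 2 ^ j)%N.
  by rewrite (leq_trans (count_size _ _)) // size_take_min geq_minl.
have p0 : 0 <= p by rewrite subr_ge0.
apply: ler_pM => //.
- rewrite mulrC subr_ge0 ler_pdivrMr // mul1r ler_nat //.
- by rewrite -(avg_const (G * j) 0); apply: avg_le => cs _; rewrite ler0n.
- by rewrite [_^-1 * _]mulrC; apply: bernoulli; rewrite K1 ltW.
Qed.

End Average.

(** * Iterated phases: program length, shrinking of the columns, failure probability *)

Section Phases.
Variables (n j : nat) (M : nat -> nat -> bool).
Implicit Types (X : seq nat) (cs : seq bool) (Z : work).

Definition random_phase cs Z : work := phase n M (sample j (cols Z) cs n) Z.

Fixpoint random_phases (L : nat) cs Z : work :=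
  if L is L'.+1 then random_phases L' (drop (n * j) cs) (random_phase cs Z)
  else Z.

(** Peels off the last phase instead of the first, as the invariant of a loop over the phases
    requires. *)
Lemma random_phasesS L cs Z :
  random_phases L.+1 cs Z =
    random_phase (drop (L * (n * j)) cs) (random_phases L cs Z).
Proof.
elim: L cs Z => [|L IH] cs Z; first by rewrite /= mul0n drop0.
by rewrite -[LHS]/(random_phases L.+1 _ _) IH drop_drop addnC -mulSn.
Qed.

Lemma work_ok_random_phases L cs Z :
  work_ok n Z -> work_ok n (random_phases L cs Z).
Proof. by elim: L cs Z => //= L IH cs Z okZ; apply/IH/work_ok_phase. Qed.

(** Ranging over all pairs of indices, not only surviving rows, makes the event depend on the past
    through [X] alone. *)
Definition bad_sample (tau : nat) X cs : bool :=
  has (fun y => has (fun q =>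
    (tau < count (fun x => M y x != M q x) X) && agree M (sample j X cs n) y q)
    (iota 0 n)) (iota 0 n).

Fixpoint bad_phases (tau L : nat) cs Z : bool :=
  if L is L'.+1 then
    bad_sample tau (cols Z) cs
    || bad_phases tau L' (drop (n * j) cs) (random_phase cs Z)
  else false.

Lemma potential_random_phases tau L cs Z :
  work_ok n Z -> ~~ bad_phases tau L cs Z ->
  potential tau (random_phases L cs Z) <= potential tau Z.
Proof.
elim: L cs Z => //= L IH cs Z okZ; rewrite negb_or => /andP[good goods].
apply: leq_trans (IH _ _ _ goods) _; first exact: work_ok_phase.
apply: potential_phase => y Yy; rewrite leqNgt; apply/negP => gt.
have [_ ltY] := work_ok_rows okZ.
have [Yr ar] := repP M (sample j (cols Z) cs n) Yy.
case/negP: good; apply/hasP; exists y; first by rewrite mem_iota ltY.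
apply/hasP; exists (rep M (sample j (cols Z) cs n) (rows Z) y).
  by rewrite mem_iota ltY.
by rewrite gt ar.
Qed.

Lemma bad_phases_cat tau L cs cs' Z : L * (n * j) <= size cs ->
  bad_phases tau L (cs ++ cs') Z = bad_phases tau L cs Z.
Proof.
elim: L cs Z => //= L IH cs Z; rewrite mulSn => le.
have le1 : n * j <= size cs by apply: leq_trans le; rewrite leq_addr.
have drop_cat1 : drop (n * j) (cs ++ cs') = drop (n * j) cs ++ cs'.
  rewrite drop_cat; case: ltnP => // ge.
  have -> : n * j - size cs = 0 by lia.
  by rewrite drop0 drop_oversize.
rewrite /bad_sample /random_phase !sample_cat // drop_cat1 IH //.
by rewrite size_drop; lia.
Qed.

Lemma size_cols_phase T Z : size (cols (phase n M T Z)) <= size (cols Z).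
Proof. by rewrite size_filter count_size. Qed.

Section Shrinking.
Variable c : nat.
Hypothesis shatter : forall T Y, uniq Y -> {in T, forall t, t < n} ->
  {in Y, forall y, y < n} ->
  {in Y &, forall y z, agree M T y z -> y = z} -> size Y <= c * size T + 1.
Hypothesis large_block : 2 * (c * c) <= 2 ^ j.

(** The trace bound is used for rows distinct on the sample, then for columns distinct on those
    rows. [large_block] turns the resulting [2 * (c * c) * size T] into [2 ^ j * size T], hence into
    [size (cols Z) + 2 ^ j]; [2 * c] and [2] stem from the two [+ 1]. *)
Lemma size_cols_random_phase cs Z : work_ok n Z ->
  2 * size (cols (random_phase cs Z)) <= size (cols Z) + (2 ^ j + 2 * c + 2).
Proof.
move=> okZ; have [uY ltY] := work_ok_rows okZ; case: okZ => _ uX ltX _.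
rewrite /random_phase; set T := sample _ _ _ _; set Y' := reps M T (rows Z).
have leY : size Y' <= c * size T + 1.
  apply: shatter; rewrite ?filter_uniq //.
  - by move=> t /sample_sub/ltX.
  - by move=> y /mem_reps/ltY.
  - by move=> y z; apply: reps_agree.
have leX : size (cols (phase n M T Z)) <= c * size Y' + 1.
  apply: shatter; rewrite ?filter_uniq //.
  - by move=> y /mem_reps/ltY.
  - by move=> x /mem_reps/ltX.
  - by move=> x z; apply: reps_agree.
have := size_sample j (cols Z) cs n; rewrite -/T => leT.
have : 2 * (c * c) * size T <= 2 ^ j * size T by rewrite leq_mul2r large_block orbT.
have : c * size Y' <= c * (c * size T + 1) by rewrite leq_mul2l leY orbT.
by rewrite mulnDr mulnA muln1; lia.
Qed.

(** [2 ^ j + 2 * c + 2] is the fixed point of the recursion, so the excess over it halves in each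
    phase; the additive form avoids truncated subtraction. *)
Lemma size_cols_random_phases L cs Z : work_ok n Z ->
  2 ^ L * size (cols (random_phases L cs Z)) + (2 ^ j + 2 * c + 2)
  <= size (cols Z) + 2 ^ L * (2 ^ j + 2 * c + 2).
Proof.
elim: L cs Z => [|L IH] cs Z okZ /=; first by rewrite expn0 !mul1n.
have := size_cols_random_phase cs okZ.
have /(IH (drop (n * j) cs)) : work_ok n (random_phase cs Z).
  exact: work_ok_phase.
rewrite expnS; set a := size _; set b := size (cols (random_phase _ _)).
set K := (2 ^ j + _ + _); have : 0 < 2 ^ L by rewrite expn_gt0.
by set P := 2 ^ L; nia.
Qed.

End Shrinking.

Section Probability.
Variable R : realFieldType.
Local Open Scope ring_scope.
Let p : R := 1 - (2 ^ j)%:R^-1.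

Lemma p_ge0 : 0 <= p.
Proof. by rewrite subr_ge0 invf_le1 ?ler1n ?ltr0n expn_gt0. Qed.

Lemma indicator_has (I : eqType) (P : pred I) (r : seq I) :
  (has P r)%:R <= \sum_(i <- r) (P i)%:R :> R.
Proof.
elim: r => [|i r IH] /=; first by rewrite big_nil.
rewrite big_cons; case: (P i) => /=; last by rewrite add0r.
by rewrite lerDl sumr_ge0 // => k _; rewrite ler0n.
Qed.

Lemma avg_bad_sample tau X : (size X <= n)%N ->
  avg (n * j) (fun cs => (bad_sample tau X cs)%:R) <= (n * n)%:R * p ^+ tau.
Proof.
move=> leX; pose B y q cs : R :=
  ((tau < count (fun x => M y x != M q x) X)%N && agree M (sample j X cs n) y q)%:R.
have le cs : (bad_sample tau X cs)%:R <= \sum_(y <- iota 0 n) \sum_(q <- iota 0 n) B y q cs.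
  apply: le_trans (indicator_has _ _) _; apply: ler_sum => y _.
  exact: indicator_has.
apply: le_trans (avg_le (fun cs _ => le cs)) _; rewrite avg_sum.
have -> : (n * n)%:R * p ^+ tau = \sum_(y <- iota 0 n) \sum_(q <- iota 0 n) p ^+ tau.
  by rewrite !big_const_seq !count_predT size_iota !iter_addr_0 natrM -mulrA !mulr_natl.
apply: ler_sum => y _; rewrite avg_sum; apply: ler_sum => q _.
rewrite /B; case: ltnP => [lt|_] /=; last by rewrite avg_const exprn_ge0 ?p_ge0.
apply: (@le_trans _ _ (p ^+ count (fun x => M y x != M q x) X)).
  (* Agreement on the sample means that the sample misses every column of difference. *)
  rewrite (@eq_avg _ _ _ (fun cs =>
    (~~ has (fun x => M y x != M q x) (sample j X cs n))%:R)); last first.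
    move=> cs _; congr (_%:R); congr nat_of_bool; rewrite -all_predC.
    by apply: eq_all => x /=; rewrite negbK.
  by apply: avg_miss; rewrite (leq_trans leX) // leq_pmulr // expn_gt0.
apply: ler_wiXn2l; rewrite ?p_ge0 //; last exact: ltnW.
by rewrite gerBl invr_ge0 ler0n.
Qed.

(** Fixing the coins [u] of the first phase fixes the next state, to which the induction hypothesis
    applies because it holds for every [Z]; so the dependence on earlier coins does no harm. *)
Lemma avg_bad_phases tau L Z : (size (cols Z) <= n)%N ->
  avg (L * (n * j)) (fun cs => (bad_phases tau L cs Z)%:R)
  <= (L * (n * n))%:R * p ^+ tau.
Proof.
elim: L Z => [|L IH] Z leX; first by rewrite mul0n avg_const mul0r.
rewrite mulSn avg_add.
have le u : size u = (n * j)%N ->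
    avg (L * (n * j)) (fun v => (bad_phases tau L.+1 (u ++ v) Z)%:R)
    <= (bad_sample tau (cols Z) u)%:R + (L * (n * n))%:R * p ^+ tau.
  move=> szu.
  have E v : bad_phases tau L.+1 (u ++ v) Z =
      bad_sample tau (cols Z) u || bad_phases tau L v (random_phase u Z).
    by rewrite /= /bad_sample /random_phase !sample_cat ?szu // -szu drop_size_cat.
  apply: le_trans (_ : _ <= (bad_sample tau (cols Z) u)%:R +
    avg (L * (n * j)) (fun v => (bad_phases tau L v (random_phase u Z))%:R)) _.
    rewrite -[X in _ <= X + _](avg_const (L * (n * j))) -avgD.
    apply: avg_le => v _; rewrite E.
    by case: (bad_sample _ _ _); case: (bad_phases _ _ _ _); rewrite /= ?addr0 ?add0r ?lerDl.
  by rewrite lerD2l IH // (leq_trans (size_cols_phase _ _)).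
apply: le_trans (avg_le le) _; rewrite avgD avg_const mulSn natrD mulrDl lerD2r.
exact: avg_bad_sample.
Qed.

End Probability.
End Phases.

(** * Program logic *)

Fixpoint wmods (c : cmd) : seq nat :=
  match c with
  | Seq c1 c2 | If _ c1 c2 => wmods c1 ++ wmods c2
  | While _ c1 => wmods c1
  | WAssign x _ | Flip x => [:: x]
  | _ => [::]
  end.

Fixpoint amods (c : cmd) : seq nat :=
  match c with
  | Seq c1 c2 | If _ c1 c2 => amods c1 ++ amods c2
  | While _ c1 => amods c1
  | WWrite a _ _ => [:: a]
  | _ => [::]
  end.

Fixpoint gmods (c : cmd) : seq nat :=
  match c with
  | Seq c1 c2 | If _ c1 c2 => gmods c1 ++ gmods c2
  | While _ c1 => gmods c1
  | GWrite a _ _ => [:: a]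
  | _ => [::]
  end.

Fixpoint coinfree (c : cmd) : bool :=
  match c with
  | Seq c1 c2 | If _ c1 c2 => coinfree c1 && coinfree c2
  | While _ c1 => coinfree c1
  | Flip _ => false
  | _ => true
  end.

Fixpoint straight (c : cmd) : bool :=
  match c with
  | Seq c1 c2 | If _ c1 c2 => straight c1 && straight c2
  | While _ _ => false
  | _ => true
  end.

Fixpoint cost (c : cmd) : nat :=
  match c with
  | Seq c1 c2 | If _ c1 c2 => (cost c1 + cost c2).+1
  | While _ c1 => cost c1
  | _ => 1
  end.

Definition For (i v : nat) (body : cmd) : cmd :=
  Seq (WAssign i (WConst 0))
    (While (WOp OpLt (WVar i) (WVar v))
       (Seq body (WAssign i (WOp OpAdd (WVar i) (WConst 1))))).

Section Logic.
Variables (A : zmodType) (w : nat).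
Implicit Types (s : state A) (c : cmd) (Q : state A -> Prop).

(** Quantifying over the pending commands lets runs be concatenated without tracking the stack. *)
Definition runs c s (t : nat) s' : Prop :=
  forall k, iter t (step w) (c :: k, s) = (k, s').

Definition frame c s s' : Prop :=
  [/\ forall x, x \notin wmods c -> wvar s' x = wvar s x,
      forall a, a \notin amods c -> warr s' a = warr s a,
      forall a, a \notin gmods c -> garr s' a = garr s a &
      coinfree c -> coins s' = coins s].

Definition triple c s (b : nat) Q : Prop :=
  exists t s', [/\ t <= b, runs c s t s' & Q s'].

(** [P] is meant to be syntactic, such as not writing a given variable: it passes to the whole stack
    because a step only pushes subcommands or keeps the loop being run. *)
Lemma steps_invariant (P : cmd -> bool) (I : state A -> Prop) :
  (forall c k s, P c -> I s -> all P k ->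
     all P (step w (c :: k, s)).1 /\ I (step w (c :: k, s)).2) ->
  forall t k s, all P k -> I s -> I (iter t (step w) (k, s)).2.
Proof.
move=> hstep t k s Pk Is.
suff : all P (iter t (step w) (k, s)).1 /\ I (iter t (step w) (k, s)).2 by case.
elim: t => //= t [+ +]; case: (iter t _ _) => [[|c k'] s'] //= /andP[Pc Pk'] Is'.
exact: hstep.
Qed.

Lemma runs_frame c s t s' : runs c s t s' -> frame c s s'.
Proof.
move=> /(_ [::]) E; split=> [x|a|a|] h.
- have := @steps_invariant (fun c => x \notin wmods c)
    (fun s' => wvar s' x = wvar s x) _ t [:: c] s.
  rewrite E /= h; apply=> // c' k s0.
  case: c' => //= [c1 c2|e c1 c2|e c1|y e|y]; rewrite ?mem_cat ?inE ?negb_or.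
  + by case/andP=> -> -> -> ->.
  + by case/andP=> h1 h2 -> ->; case: ifP; rewrite ?h1 ?h2.
  + by move=> h1 -> hk; case: ifP; rewrite /= ?h1 ?hk.
  + by rewrite /upd; case: eqP.
  + by rewrite /upd; case: eqP.
- have := @steps_invariant (fun c => a \notin amods c)
    (fun s' => warr s' a = warr s a) _ t [:: c] s.
  rewrite E /= h; apply=> // c' k s0.
  case: c' => //= [c1 c2|e c1 c2|e c1|y e e']; rewrite ?mem_cat ?inE ?negb_or.
  + by case/andP=> -> -> -> ->.
  + by case/andP=> h1 h2 -> ->; case: ifP; rewrite ?h1 ?h2.
  + by move=> h1 -> hk; case: ifP; rewrite /= ?h1 ?hk.
  + by rewrite /upd; case: eqP.
- have := @steps_invariant (fun c => a \notin gmods c)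
    (fun s' => garr s' a = garr s a) _ t [:: c] s.
  rewrite E /= h; apply=> // c' k s0.
  case: c' => //= [c1 c2|e c1 c2|e c1|y e e']; rewrite ?mem_cat ?inE ?negb_or.
  + by case/andP=> -> -> -> ->.
  + by case/andP=> h1 h2 -> ->; case: ifP; rewrite ?h1 ?h2.
  + by move=> h1 -> hk; case: ifP; rewrite /= ?h1 ?hk.
  + by rewrite /upd; case: eqP.
- have := @steps_invariant coinfree (fun s' => coins s' = coins s) _ t [:: c] s.
  rewrite E /= h; apply=> // c' k s0.
  case: c' => //= [c1 c2|e c1 c2|e c1].
  + by case/andP=> -> -> -> ->.
  + by case/andP=> h1 h2 -> ->; case: ifP; rewrite ?h1 ?h2.
  + by move=> h1 -> hk; case: ifP; rewrite /= ?h1 ?hk.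
Qed.

Lemma triple_frame c s b Q : triple c s b Q ->
  triple c s b (fun s' => Q s' /\ frame c s s').
Proof.
by case=> t [s' [le r q]]; exists t, s'; split=> //; split=> //; apply: runs_frame r.
Qed.

Lemma triple_conseq c s b b' Q Q' : triple c s b Q -> b <= b' ->
  (forall s', frame c s s' -> Q s' -> Q' s') -> triple c s b' Q'.
Proof.
case=> t [s' [le r q]] leb QQ'; exists t, s'; split=> //; first exact: leq_trans leb.
by apply: QQ' => //; apply: runs_frame r.
Qed.

Lemma triple_seq c1 c2 s b1 b2 b Q :
  triple c1 s b1 (fun s' => triple c2 s' b2 Q) -> (b1 + b2).+1 <= b ->
  triple (Seq c1 c2) s b Q.
Proof.
case=> t1 [s1 [le1 r1 [t2 [s2 [le2 r2 q]]]]] le.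
exists (t2 + t1).+1, s2; split=> //; first by lia.
by move=> k; rewrite iterSr /= iterD r1 r2.
Qed.

Lemma triple_if e c1 c2 s b b' Q :
  (eval w s e != 0 -> triple c1 s b Q) -> (eval w s e = 0 -> triple c2 s b Q) ->
  b < b' -> triple (If e c1 c2) s b' Q.
Proof.
move=> h1 h2 lt; have [E|ne] := eqVneq (eval w s e) 0.
  have [t [s' [le r q]]] := h2 E; exists t.+1, s'; split=> //; first exact: leq_ltn_trans lt.
  by move=> k; rewrite iterSr /= E eqxx r.
have [t [s' [le r q]]] := h1 ne; exists t.+1, s'; split=> //; first exact: leq_ltn_trans lt.
by move=> k; rewrite iterSr /= ne r.
Qed.

Fixpoint sem c s : state A :=
  match c with
  | Skip => s
  | Seq c1 c2 => sem c2 (sem c1 s)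
  | If e c1 c2 => if eval w s e != 0 then sem c1 s else sem c2 s
  | While _ _ => s
  | WAssign x e => set_wvar s x (eval w s e)
  | WWrite a i e => set_warr s a (eval w s i) (eval w s e)
  | Flip x => flip w s x
  | GAssign x g => set_gvar s x (geval w s g)
  | GWrite a i g => set_garr s a (eval w s i) (geval w s g)
  end.

Lemma triple_sem c s b Q : straight c -> cost c <= b -> Q (sem c s) ->
  triple c s b Q.
Proof.
elim: c s b Q => //= [|c1 IH1 c2 IH2|e c1 IH1 c2 IH2|x e|a i e|x|x g|a i g] s b Q.
- by move=> _ le q; exists 1, s.
- case/andP=> st1 st2 le q; apply: (@triple_seq _ _ _ (cost c1) (cost c2)) => //.
  by apply: IH1 => //; apply: IH2.
- case/andP=> st1 st2; move=> le q; apply: (triple_if (b := cost c1 + cost c2)) => // E.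
    by apply: IH1 => //; [exact: leq_addr | move: q; rewrite E].
  by apply: IH2 => //; [exact: leq_addl | move: q; rewrite E].
- by move=> _ le q; eexists 1, _; split; last exact: q.
- by move=> _ le q; eexists 1, _; split; last exact: q.
- by move=> _ le q; eexists 1, _; split; last exact: q.
- by move=> _ le q; eexists 1, _; split; last exact: q.
- by move=> _ le q; eexists 1, _; split; last exact: q.
Qed.

Lemma frame_trans c s s' s'' : frame c s s' -> frame c s' s'' -> frame c s s''.
Proof.
case=> h1 h2 h3 h4 [k1 k2 k3 k4]; split=> [x hx|a ha|a ha|hc].
- by rewrite k1 ?h1.
- by rewrite k2 ?h2.
- by rewrite k3 ?h3.
- by rewrite k4 ?h4.
Qed.

(** The body ends before the counter is incremented, hence the invariant after it speaks of the
    state with [i] already set to [k + 1]. An iteration adds 3 units (test, sequencing, increment),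
    the loop another 3 (sequencing, initialisation, last test). [m < 2 ^ w] keeps the counter from
    wrapping. *)
Lemma triple_for (I : nat -> state A -> Prop) i v body s m b bnd Q :
  0 < w -> m < 2 ^ w ->
  i != v -> i \notin wmods body -> v \notin wmods body ->
  wvar s v = m -> I 0 (set_wvar s i 0) ->
  (forall k s', k < m -> frame (For i v body) s s' -> wvar s' i = k -> I k s' ->
     triple body s' b (fun s'' => I k.+1 (set_wvar s'' i k.+1))) ->
  (forall s', frame (For i v body) s s' -> I m s' -> Q s') ->
  m * (b + 3) + 3 <= bnd ->
  triple (For i v body) s bnd Q.
Proof.
move=> w0 ltm niv ni nv vs I0 Ibody IQ le.
have w1 : 1 < 2 ^ w by rewrite -{1}[1](expn0 2) ltn_exp2l.
have word_id x : x < 2 ^ w -> word w x = x by exact: modn_small.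
pose W := While (WOp OpLt (WVar i) (WVar v))
       (Seq body (WAssign i (WOp OpAdd (WVar i) (WConst 1)))).
have fr_upd s' k : frame (For i v body) s' (set_wvar s' i k).
  by split=> // x; rewrite /= /upd inE negb_or; case: eqP.
have fr_body s' s'' : frame body s' s'' -> frame (For i v body) s' s''.
  case=> h1 h2 h3 h4; split=> [x|a|a|] /=.
  - by rewrite inE mem_cat !negb_or => /and3P[_ ? _]; apply: h1.
  - by rewrite cats0; apply: h2.
  - by rewrite cats0; apply: h3.
  - by rewrite andbT; apply: h4.
have vFor : v \notin wmods (For i v body).
  by rewrite /= !inE mem_cat !inE !negb_or (eq_sym v) niv nv.
have main d k s' : k + d = m -> frame (For i v body) s s' -> wvar s' i = k -> I k s' ->
    triple W s' (d * (b + 3) + 1) (fun s' => frame (For i v body) s s' /\ I m s').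
  elim: d k s' => [|d IH] k s' kd fr ik Ik.
    exists 1, s'; split=> //; last by split; rewrite // -kd addn0.
    move=> K /=; rewrite ik; case: (fr) => -> // _ _ _.
    by rewrite vs -kd addn0 ltnn /word mod0n.
  have vk : wvar s' v = m by case: (fr) => ->.
  have ltk : k < m by lia.
  have [t [s1 [le1 r1 [I1 fr1]]]] := triple_frame (Ibody k s' ltk fr ik Ik).
  have is1 : wvar s1 i = k by case: fr1 => ->.
  have kd' : k.+1 + d = m by lia.
  have [|||t2 [s2 [le2 r2 q2]]] := IH k.+1 (set_wvar s1 i k.+1) kd'.
  - exact: frame_trans (frame_trans fr (fr_body _ _ fr1)) (fr_upd s1 k.+1).
  - by rewrite /= /upd eqxx.
  - exact: I1.
  exists (t2 + (1 + (t + 2))), s2; split=> //; first by rewrite mulSn; lia.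
  move=> K; rewrite iterD (iterD 1) (iterD t).
  have -> : iter 2 (step w) (W :: K, s') =
      (body :: WAssign i (WOp OpAdd (WVar i) (WConst 1)) :: W :: K, s').
    by rewrite /= ik vk ltk word_id.
  rewrite r1 /= is1 (word_id 1) // addn1 word_id ?r2 //.
  exact: leq_ltn_trans ltk ltm.
have i0 : wvar (set_wvar s i 0) i = 0 by rewrite /= /upd eqxx.
have [t [s' [let' r [fr Im]]]] := main m 0 _ (add0n m) (fr_upd s 0) i0 I0.
exists (t + 2), s'; split=> //; [by lia | | exact: IQ].
by move=> K; rewrite iterD [iter 2 _ _]/= /word mod0n r.
Qed.

End Logic.

(** * The program *)

Local Notation v_n := 0 (only parsing).
Local Notation v_p := 1 (only parsing).
Local Notation v_L := 2 (only parsing).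
Local Notation v_LN := 3 (only parsing).
Local Notation v_r := 5 (only parsing).
Local Notation v_coin := 6 (only parsing).
Local Notation v_ny := 7 (only parsing).
Local Notation v_nx := 8 (only parsing).
Local Notation v_ph := 9 (only parsing).
Local Notation v_g := 10 (only parsing).
Local Notation v_idx := 11 (only parsing).
Local Notation v_t := 12 (only parsing).
Local Notation v_i := 13 (only parsing).
Local Notation v_y := 14 (only parsing).
Local Notation v_z := 15 (only parsing).
Local Notation v_cnt := 16 (only parsing).
Local Notation v_m := 17 (only parsing).
Local Notation v_ne := 18 (only parsing).
Local Notation v_x := 19 (only parsing).
Local Notation v_sg := 20 (only parsing).
Local Notation v_dst := 21 (only parsing).
Local Notation v_src := 22 (only parsing).
Local Notation a_M := 0 (only parsing).
Local Notation a_Y := 1 (only parsing).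
Local Notation a_X := 2 (only parsing).
Local Notation a_rep := 3 (only parsing).
Local Notation a_new := 4 (only parsing).
Local Notation a_rnd := 5 (only parsing).
Local Notation a_sg := 6 (only parsing).
Local Notation a_dst := 7 (only parsing).
Local Notation a_src := 8 (only parsing).
Local Notation a_el := 9 (only parsing).
Local Notation a_par := 10 (only parsing).

Declare Scope cmd_scope.
Local Notation "c1 ;; c2" := (Seq c1 c2)
  (at level 80, right associativity) : cmd_scope.
Local Notation "x ::= e" := (WAssign x e) (at level 70) : cmd_scope.
Local Open Scope cmd_scope.
Local Notation "e +w f" := (WOp OpAdd e f) (at level 50, left associativity).
Local Notation "e -w f" := (WOp OpSub e f) (at level 50, left associativity).
Local Notation "e *w f" := (WOp OpMul e f) (at level 40, left associativity).
Local Notation "e =w f" := (WOp OpEq e f) (at level 60).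
Local Notation "e <w f" := (WOp OpLt e f) (at level 60).

Definition Mread (u v : nat) : word_expr :=
  WRead a_M (WVar u *w WVar v_n +w WVar v).

Definition init_reps (a len : nat) : cmd :=
  For v_i len (WWrite a_rep (WRead a (WVar v_i)) (WRead a (WConst 0))).

(* a_new[q] is the representative of the elements split off from the class of
   q, or n if there is none so far. *)
Definition refine_body (a : nat) : cmd :=
  v_y ::= WRead a (WVar v_i) ;;
  v_z ::= WRead a_rep (WVar v_y) ;;
  If (Mread v_y v_t =w Mread v_z v_t) Skip
    (If (WRead a_new (WVar v_z) =w WVar v_n)
       (WWrite a_new (WVar v_z) (WVar v_y)) Skip ;;
     WWrite a_rep (WVar v_y) (WRead a_new (WVar v_z))).

Definition refine (a len : nat) : cmd :=
  For v_i len (WWrite a_new (WRead a (WVar v_i)) (WVar v_n)) ;;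
  For v_i len (refine_body a).

Definition emit : cmd :=
  WWrite a_sg (WVar v_m) (WVar v_sg) ;;
  WWrite a_dst (WVar v_m) (WVar v_dst) ;;
  WWrite a_src (WVar v_m) (WVar v_src) ;;
  v_m ::= WVar v_m +w WConst 1.

Definition sample_rows (j : nat) : cmd :=
  For v_g v_n
    (v_idx ::= WVar v_g *w WConst (2 ^ j)
               +w WRead a_rnd (WVar v_ph *w WVar v_n +w WVar v_g) ;;
     If (WVar v_idx <w WVar v_nx)
       (v_t ::= WRead a_X (WVar v_idx) ;; refine a_Y v_ny)
       Skip).

Definition elim_entry : cmd :=
  v_x ::= WRead a_X (WVar v_i) ;;
  If (Mread v_y v_x =w Mread v_z v_x) Skip
    (v_sg ::= Mread v_z v_x ;;
     v_dst ::= WVar v_y ;;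
     v_src ::= WVar v_n +w WVar v_x ;;
     emit).

Definition elim_last : cmd :=
  v_sg ::= WConst 1 ;;
  v_dst ::= WVar v_y ;;
  v_src ::= WVar v_z ;;
  emit ;;
  WWrite a_el (WVar v_ne) (WVar v_y) ;;
  WWrite a_par (WVar v_ne) (WVar v_z) ;;
  v_ne ::= WVar v_ne +w WConst 1.

Definition elim_body : cmd := For v_i v_nx elim_entry ;; elim_last.

Definition compact_rows : cmd :=
  v_cnt ::= WConst 0 ;;
  For v_g v_ny
    ((v_y ::= WRead a_Y (WVar v_g) ;; v_z ::= WRead a_rep (WVar v_y)) ;;
     If (WVar v_y =w WVar v_z)
       (WWrite a_Y (WVar v_cnt) (WVar v_y) ;; v_cnt ::= WVar v_cnt +w WConst 1)
       elim_body) ;;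
  v_ny ::= WVar v_cnt.

Definition refine_cols : cmd :=
  For v_g v_ny (v_t ::= WRead a_Y (WVar v_g) ;; refine a_X v_nx).

Definition compact_cols : cmd :=
  v_cnt ::= WConst 0 ;;
  For v_g v_nx
    (v_x ::= WRead a_X (WVar v_g) ;;
     v_z ::= WRead a_rep (WVar v_x) ;;
     If (WVar v_x =w WVar v_z)
       (WWrite a_X (WVar v_cnt) (WVar v_x) ;; v_cnt ::= WVar v_cnt +w WConst 1)
       (v_sg ::= WConst 0 ;;
        v_dst ::= WVar v_n +w WVar v_z ;;
        v_src ::= WVar v_n +w WVar v_x ;;
        emit)) ;;
  v_nx ::= WVar v_cnt.

Definition phase_cmd (j : nat) : cmd :=
  init_reps a_Y v_ny ;; sample_rows j ;; compact_rows ;;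
  init_reps a_X v_nx ;; refine_cols ;; compact_cols.

(** [v_L] counts the powers of two up to [n], which gives [trunc_log 2 n + 1] without a logarithm;
    the guard stops the doubling, so [v_p] never exceeds [2 * n]. *)
Definition count_phases : cmd :=
  v_p ::= WConst 1 ;;
  For v_i v_n
    (If (WVar v_n <w WVar v_p) Skip
       (v_p ::= WVar v_p +w WVar v_p ;; v_L ::= WVar v_L +w WConst 1)) ;;
  v_LN ::= WVar v_L *w WVar v_n.

(** Unrolled, since the number of coins per draw is a constant of the program. *)
Fixpoint flips (m : nat) : cmd :=
  if m is m'.+1 then
    (Flip v_coin ;; v_r ::= WConst 2 *w WVar v_r +w WVar v_coin) ;; flips m'
  else Skip.

Definition toss (j : nat) : cmd :=
  For v_i v_LN
    (v_r ::= WConst 0 ;; flips j ;; WWrite a_rnd (WVar v_i) (WVar v_r)).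

Definition init_lists : cmd :=
  For v_i v_n
    (WWrite a_Y (WVar v_i) (WVar v_i) ;; WWrite a_X (WVar v_i) (WVar v_i)) ;;
  v_ny ::= WVar v_n ;;
  v_nx ::= WVar v_n.

(** Group array 1 holds [2 * n] registers, each a row of [n] group elements: cell [a * n + c] is
    coordinate [c] of register [a]. Registers from [n] on receive the rows of N, and the first [n]
    end up as the output in row-major order. *)
Definition copy_input : cmd :=
  For v_g v_n (For v_i v_n
    (GWrite 1 ((WVar v_n +w WVar v_g) *w WVar v_n +w WVar v_i)
       (GRead 0 (WVar v_g *w WVar v_n +w WVar v_i)))).

Definition brute_force_cmd : cmd :=
  For v_g v_ny
    (v_y ::= WRead a_Y (WVar v_g) ;;
     For v_i v_nx
       (v_x ::= WRead a_X (WVar v_i) ;;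
        If (Mread v_y v_x)
          (v_sg ::= WConst 0 ;;
           v_dst ::= WVar v_y ;;
           v_src ::= WVar v_n +w WVar v_x ;;
           emit)
          Skip)).

Definition back_substitution_cmd : cmd :=
  For v_g v_ne
    (v_sg ::= WConst 0 ;;
     v_dst ::= WRead a_el (WVar v_ne -w (WVar v_g +w WConst 1)) ;;
     v_src ::= WRead a_par (WVar v_ne -w (WVar v_g +w WConst 1)) ;;
     emit).

Definition interpreter_cell (a : nat) : word_expr :=
  WRead a (WVar v_g) *w WVar v_n +w WVar v_i.

Definition interpreter_step : cmd :=
  If (WRead a_sg (WVar v_g))
    (GWrite 1 (interpreter_cell a_dst)
       (GAdd (GRead 1 (interpreter_cell a_dst))
             (GOpp (GRead 1 (interpreter_cell a_src)))))
    (GWrite 1 (interpreter_cell a_dst)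
       (GAdd (GRead 1 (interpreter_cell a_dst))
             (GRead 1 (interpreter_cell a_src)))).

Definition interpreter : cmd := For v_g v_m (For v_i v_n interpreter_step).

Definition main_cmd (j : nat) : cmd :=
  count_phases ;; toss j ;; init_lists ;; copy_input ;;
  For v_ph v_L (phase_cmd j) ;;
  brute_force_cmd ;; back_substitution_cmd ;; interpreter.

(** * The program implements the abstract phases within the stated time *)

Section Verification.
Variables (A : zmodType) (w n j : nat) (M : nat -> nat -> bool).
Hypothesis capacity : 2 ^ j * (4 * n.+1 ^ 2) <= 2 ^ w.
Implicit Types (s : state A) (l T X Y : seq nat) (p : seq instr)
  (E : seq (nat * nat)) (cs : seq bool).

Lemma cap4 : 4 * n.+1 ^ 2 <= 2 ^ w.
Proof. by apply: leq_trans capacity; rewrite leq_pmull // expn_gt0. Qed.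

(** The summands bound the eliminations, the brute force and the back substitution; [n * n.+2] is
    the initial value of [potential n]. So the instruction counter never overflows. *)
Lemma cap_prog : n * n.+2 + (n * n + n) < 4 * n.+1 ^ 2.
Proof. by clear; nia. Qed.

Lemma w_gt0 : 0 < w.
Proof. by have := cap4; case: (w) => // h; rewrite expn0 in h; nia. Qed.

Lemma word_small x : x < 4 * n.+1 ^ 2 -> word w x = x.
Proof. by move=> lt; apply/modn_small/(leq_trans lt)/cap4. Qed.

Lemma word_bool (b : bool) : word w b = b.
Proof. by apply: word_small; case: b; nia. Qed.

Lemma word_le_n x : x <= n.+1 -> word w x = x.
Proof. by move=> le; apply: word_small; nia. Qed.

Definition base s : Prop :=
  wvar s v_n = n /\
  forall y x, y < n -> x < n -> warr s a_M (y * n + x) = M y x.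

Definition list_at s (a : nat) l : Prop :=
  forall i, i < size l -> warr s a i = nth 0 l i.

Lemma eval_Mread s u v : base s -> wvar s u < n -> wvar s v < n ->
  eval w s (Mread u v) = M (wvar s u) (wvar s v).
Proof.
case=> sn sM lu lv; rewrite /= sn (word_small (x := _ * _)); last by nia.
by rewrite word_small ?sM //; nia.
Qed.

Lemma base_frame c s s' : frame c s s' -> v_n \notin wmods c ->
  a_M \notin amods c -> base s -> base s'.
Proof. by move=> [fw fa _ _] hv ha [sn sM]; rewrite /base fw // fa. Qed.

Lemma eqn_bool (b1 b2 : bool) : (b1 == b2 :> nat) = (b1 == b2).
Proof. by case: b1 b2 => [] []. Qed.

Lemma mem_takeS l k x : k < size l ->
  (x \in take k.+1 l) = (x == nth 0 l k) || (x \in take k l).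
Proof. by move=> lt; rewrite (take_nth 0 lt) mem_rcons inE. Qed.

Lemma small_size l : uniq l -> {in l, forall y, y < n} -> size l <= n.
Proof.
move=> ul ltl; rewrite -[n](size_iota 0); apply: uniq_leq_size => // y /ltl.
by rewrite mem_iota.
Qed.

Lemma size_fits l : uniq l -> {in l, forall y, y < n} -> size l < 2 ^ w.
Proof.
by move=> ul ltl; have := small_size ul ltl; have := cap4; nia.
Qed.

Lemma init_reps_spec s a len l :
  a != a_rep -> len != v_i -> list_at s a l -> wvar s len = size l ->
  uniq l -> {in l, forall y, y < n} ->
  triple w (init_reps a len) s (n * 4 + 3)
    (fun s' => {in l, forall y, warr s' a_rep y = rep M [::] l y}).
Proof.
move=> na nlen sl slen ul ltl; have le_l := small_size ul ltl.
apply: (triple_for (b := 1)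
  (I := fun k s' => {in take k l, forall y, warr s' a_rep y = head 0 l})
  w_gt0 (size_fits ul ltl) _ _ _ slen) => //.
- by rewrite eq_sym.
- by move=> y; rewrite take0.
- move=> k s' lt_k [_ fa _ _] ik Ik; apply: triple_sem => //= y.
  rewrite /= /word mod0n (fa a) ?inE // ik !sl ?(leq_ltn_trans _ lt_k) //.
  rewrite mem_takeS // /upd /= nth0.
  by case: eqP => //= _ /Ik.
- move=> s' _ Il y ly; rewrite Il ?take_size // rep_nil.
  by case: (l) ly.
- by nia.
Qed.

(** The second loop realises [rep_rcons]: [F k q] lists the elements split off from the class of [q]
    among the first [k], and [a_new] stores its head. The representative itself is never split off,
    so classes not yet visited are unaffected. *)
Lemma refine_spec s a len l T t :
  a \notin [:: a_rep; a_new] -> len \notin [:: v_i; v_y; v_z] ->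
  base s -> list_at s a l -> wvar s len = size l ->
  uniq l -> {in l, forall y, y < n} -> wvar s v_t = t -> t < n ->
  {in l, forall y, warr s a_rep y = rep M T l y} ->
  triple w (refine a len) s (n * 18 + 7)
    (fun s' => {in l, forall y, warr s' a_rep y = rep M (rcons T t) l y}).
Proof.
rewrite !inE !negb_or => /andP[na1 na2] /and3P[nl1 nl2 nl3].
move=> sb sl slen ul ltl st ltt srep; have le_l := small_size ul ltl.
apply: (@triple_seq _ _ _ _ _ (n * 4 + 3) (n * 14 + 3)); last by lia.
apply: (triple_for (b := 1)
  (I := fun k s' => {in take k l, forall y, warr s' a_new y = n})
  w_gt0 (size_fits ul ltl) _ _ _ slen) => //.
- by rewrite eq_sym.
- by move=> y; rewrite take0.
- move=> k s' lt_k [fw fa _ _] ik Ik; apply: triple_sem => //= y.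
  rewrite /= (fa a) ?inE // ik !sl // (fw 0) // (proj1 sb).
  rewrite mem_takeS // /upd /=.
  by case: eqP => //= _ /Ik.
- move=> s1 fr1 new1; have sb1 := base_frame fr1 isT isT sb.
  case: fr1 => fw1 fa1 _ _.
  have slen1 : wvar s1 len = size l by rewrite fw1 ?inE ?(negPf nl1).
  have sl1 : list_at s1 a l by rewrite /list_at fa1 ?inE.
  have rep1 : {in l, forall y, warr s1 a_rep y = rep M T l y} by rewrite fa1.
  have st1 : wvar s1 v_t = t by rewrite fw1.
  pose F k q := [seq y <- take k l | (rep M T l y == q) && (M y t != M q t)].
  apply: (triple_for (b := 11) (I := fun k s' =>
    {in l, forall y, warr s' a_rep y =
       if y \in take k l then rep M (rcons T t) l y else rep M T l y}
    /\ {in l, forall q, warr s' a_new q = head n (F k q)})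
    w_gt0 (size_fits ul ltl) _ _ _ slen1).
  + by rewrite eq_sym.
  + by [].
  + by rewrite /= !inE !negb_or nl2 nl3.
  + rewrite /F take0; split=> y ly /=; first exact: rep1.
    by apply: new1; rewrite take_size.
  + move=> k s' lt_k fr ik [Irep Inew]; have sb' := base_frame fr isT isT sb1.
    case: fr => fw fa _ _; set y := nth 0 l k.
    have ly : y \in l by apply: mem_nth.
    have ay : warr s' a k = y by rewrite fa ?inE ?negb_or ?na1 ?na2 // sl1.
    have yk : (y \in take k l) = false.
      apply/negbTE; move: ul; rewrite -{1}(cat_take_drop k l) cat_uniq.
      case/and3P=> _ /hasPn + _; apply; rewrite (drop_nth 0 lt_k).
      exact: mem_head.
    have ry : warr s' a_rep y = rep M T l y by rewrite Irep // yk.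
    set z := rep M T l y in ry.
    have [lz _] : z \in l /\ _ := repP M T ly.
    have st' : wvar s' v_t = t by rewrite fw.
    have FS q : F k.+1 q = if (z == q) && (M y t != M q t) then rcons (F k q) y else F k q.
      by rewrite /F (take_nth 0 lt_k) filter_rcons -/y -/z.
    apply: triple_sem => //.
    rewrite /refine_body; cbn beta iota delta [sem].
    set s3 := set_wvar (set_wvar s' _ _) _ _.
    have s3y : wvar s3 v_y = y by rewrite /s3 /= /upd /= /upd /= ik.
    have s3z : wvar s3 v_z = z by rewrite /s3 -ry /= /upd /= /upd /= ik ay.
    have s3b : base s3 by exact: sb'.
    have s3t : wvar s3 v_t = t by exact: st'.
    have -> : eval w s3 (Mread v_y v_t =w Mread v_z v_t) = (M y t == M z t).
      cbn beta iota delta [eval eval_op].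
      rewrite !eval_Mread ?s3y ?s3z ?s3t ?(ltl _ ly) ?(ltl _ lz) //.
      by rewrite eqn_bool word_bool.
    move: (Irep : {in l, forall y, warr s3 a_rep y = _}) => {}Irep.
    move: (Inew : {in l, forall y, warr s3 a_new y = _}) => {}Inew.
    clearbody s3.
    have rS := rep_rcons M T t ly; rewrite -/z in rS.
    case: eqP rS => [Mt rS|/eqP Mt rS] /=.
      split=> [y' ly'|q lq] /=.
        rewrite mem_takeS // -/y Irep //; case: eqP => [->|] //=.
        by rewrite yk rS.
      by rewrite Inew // FS; case: eqP => [<-|//]; rewrite Mt eqxx.
    have -> : warr s3 a_new (wvar s3 v_z) = head n (F k z) by rewrite s3z Inew.
    have -> : wvar s3 v_n = n by exact: (proj1 s3b).
    rewrite s3z.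
    have new_y : rep M (rcons T t) l y = head n (rcons (F k z) y).
      have -> : rcons (F k z) y = F k.+1 z by rewrite FS eqxx Mt.
      pose P q := (rep M T l q == z) && (M q t != M z t).
      rewrite rS -[[seq _ <- l | _]]/(filter P l).
      have -> : filter P l = F k.+1 z ++ filter P (drop k.+1 l).
        by rewrite -filter_cat cat_take_drop.
      by rewrite FS eqxx Mt; case: (F k z).
    (* The value [n] is a sound mark for an empty class because all list elements are below [n]. *)
    have new_n : (head n (F k z) == n) = nilp (F k z).
      case EF : (F k z) => [|q r]; first by rewrite /= eqxx.
      apply/negbTE; rewrite neq_ltn; apply/orP; left; apply: ltl.
      have : q \in F k z by rewrite EF mem_head.
      by rewrite mem_filter => /andP[_ /mem_take].
    rewrite new_n word_bool.
    have FSz q : F k.+1 q = if q == z then rcons (F k z) y else F k q.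
      rewrite FS (eq_sym z); case: eqP => //= ->.
      by rewrite Mt.
    case: nilP => EF /=.
      split=> [y' ly'|q lq] /=; rewrite /upd /= ?s3z ?s3y.
        rewrite mem_takeS // -/y; case: eqP => [->|] //=; last by rewrite Irep.
        by rewrite /upd eqxx new_y EF.
      by rewrite FSz; case: eqP => [_|_]; rewrite ?EF // Inew.
    split=> [y' ly'|q lq] /=; rewrite /upd /= ?s3z ?s3y.
      rewrite mem_takeS // -/y; case: eqP => [->|] //=; last by rewrite Irep.
      by rewrite Inew // new_y; case: (F k z) EF.
    rewrite Inew // FSz; case: eqP => [->|//].
    by case: (F k z) EF.
  + move=> s' _ [Irep _] y ly; rewrite Irep // take_size ly //.
  + by nia.
- by nia.
Qed.

Lemma sem_frame c s : straight c -> frame c s (sem w c s).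
Proof.
move=> st.
have [t [s' [_ r E]]] := @triple_sem A w c s _ (eq (sem w c s)) st (leqnn _) erefl.
by rewrite E; apply: runs_frame r.
Qed.

Definition prog_at s p : Prop :=
  wvar s v_m = size p /\
  forall e, e < size p ->
    (warr s a_sg e, warr s a_dst e, warr s a_src e) =
    (let: (sg, a, b) := nth (false, 0, 0) p e in (nat_of_bool sg, a, b)).

Definition elim_at s E : Prop :=
  wvar s v_ne = size E /\
  forall e, e < size E -> (warr s a_el e, warr s a_par e) = nth (0, 0) E e.

Lemma emit_spec s p (sg : bool) a b :
  prog_at s p -> (size p).+1 < 4 * n.+1 ^ 2 ->
  wvar s v_sg = sg -> wvar s v_dst = a -> wvar s v_src = b ->
  prog_at (sem w emit s) (rcons p (sg, a, b)).
Proof.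
move=> [sm sp] lt ssg sa sb; split=> /=.
  by rewrite /upd /= sm (word_le_n (x := 1)) // addn1 word_small // size_rcons.
move=> e; rewrite size_rcons ltnS /upd /= sm ssg sa sb nth_rcons => le.
have [->|ne] := eqVneq e (size p); first by rewrite ltnn.
have lte : e < size p by rewrite ltn_neqAle ne.
by rewrite lte sp.
Qed.

Lemma prog_frame c s s' p : frame c s s' -> v_m \notin wmods c ->
  all (fun a => a \notin amods c) [:: a_sg; a_dst; a_src] ->
  prog_at s p -> prog_at s' p.
Proof.
case=> fw fa _ _ hm /and4P[h1 h2 h3 _] [sm sp]; split; first by rewrite fw.
by move=> e lt; rewrite !fa // sp.
Qed.

Lemma elim_frame c s s' E : frame c s s' -> v_ne \notin wmods c ->
  all (fun a => a \notin amods c) [:: a_el; a_par] ->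
  elim_at s E -> elim_at s' E.
Proof.
case=> fw fa _ _ hm /and3P[h1 h2 _] [sm sp]; split; first by rewrite fw.
by move=> e lt; rewrite !fa // sp.
Qed.

Lemma list_frame c s s' a l : frame c s s' -> list_at s a l ->
  a \notin amods c -> list_at s' a l.
Proof. by case=> _ fa _ _ sl ha i lt; rewrite fa // sl. Qed.

Lemma sampleSr X cs k : sample j X cs k.+1 =
  if draw j cs k < size X then rcons (sample j X cs k) (nth 0 X (draw j cs k))
  else sample j X cs k.
Proof.
rewrite /sample -[k.+1]addn1 iotaD filter_cat map_cat /= add0n.
by case: ifP; rewrite /= ?cats1 ?cats0.
Qed.

Lemma sample_rows_spec s X Y cs ph :
  base s -> list_at s a_X X -> wvar s v_nx = size X ->
  uniq X -> {in X, forall x, x < n} ->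
  list_at s a_Y Y -> wvar s v_ny = size Y ->
  uniq Y -> {in Y, forall y, y < n} -> wvar s v_ph = ph -> ph < n ->
  (forall g, g < n ->
     warr s a_rnd (ph * n + g) = bits_val j 0 (drop (g * j) cs)) ->
  {in Y, forall y, warr s a_rep y = rep M [::] Y y} ->
  triple w (sample_rows j) s (n * (n * 18 + 15) + 3)
    (fun s' => {in Y, forall y, warr s' a_rep y = rep M (sample j X cs n) Y y}).
Proof.
move=> sb sX snx uX ltX sY sny uY ltY sph ltph srnd srep.
have ltn_w : n < 2 ^ w by have := cap4; nia.
apply: (triple_for (b := n * 18 + 12) (I := fun k s' =>
    {in Y, forall y, warr s' a_rep y = rep M (sample j X cs k) Y y})
    w_gt0 ltn_w _ _ _ (proj1 sb)) => //; last by lia.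
move=> k s' lt_k fr ik Ik; have sb' := base_frame fr isT isT sb.
have sX' := list_frame fr sX isT; have sY' := list_frame fr sY isT.
case: fr => fw fa _ _.
apply: (@triple_seq _ _ _ _ _ 1 (n * 18 + 10)); last by lia.
apply: triple_sem => //; set s1 := sem _ _ _.
have idx1 : wvar s1 v_idx = draw j cs k.
  rewrite /s1 /= /upd /= ik (fw v_ph) // sph (fw v_n) // (proj1 sb).
  rewrite (word_small (x := ph * n)); last by nia.
  rewrite (word_small (x := ph * n + k)); last by nia.
  rewrite fa // srnd // /draw.
  (* The index stays below [(k + 1) * 2 ^ j]; the factor [2 ^ j] in [capacity] keeps it from
     wrapping. *)
  have K0 : 0 < 2 ^ j by rewrite expn_gt0.
  have := bits_val_lt j 0 (drop (k * j) cs); rewrite mul1n.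
  have word_id x : x < 2 ^ w -> word w x = x by exact: modn_small.
  move=> ltb; rewrite [word w (2 ^ j)]word_id; last by nia.
  by rewrite [word w (k * _)]word_id ?word_id //; nia.
have sb1 : base s1 by exact: sb'.
have {}sX' : list_at s1 a_X X by exact: sX'.
have {}sY' : list_at s1 a_Y Y by exact: sY'.
have {}Ik : {in Y, forall y, warr s1 a_rep y = rep M (sample j X cs k) Y y} by exact: Ik.
have snx1 : wvar s1 v_nx = size X by rewrite -snx -(fw v_nx).
have sny1 : wvar s1 v_ny = size Y by rewrite -sny -(fw v_ny).
clearbody s1; rewrite sampleSr.
have ev : eval w s1 (WVar v_idx <w WVar v_nx) = (draw j cs k < size X).
  by rewrite /= idx1 snx1 word_bool.
apply: (triple_if (b := n * 18 + 9)); rewrite ?ev; last by lia.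
  case: ltnP => // lt _.
all: try by case: ltnP => // ge _; apply: triple_sem => //=; lia.
apply: (@triple_seq _ _ _ _ _ 1 (n * 18 + 7)); last by lia.
apply: triple_sem => //=.
have lXk : nth 0 X (draw j cs k) \in X by apply: mem_nth.
apply: (triple_conseq (refine_spec (s := set_wvar s1 v_t _) (len := v_ny)
  (t := nth 0 X (draw j cs k)) _ _ _ sY' sny1 uY ltY _ _ Ik)) => //=.
- by rewrite /upd /= idx1 sX'.
- exact: ltX.
Qed.

Lemma elim_body_spec s X p E y z :
  base s -> list_at s a_X X -> wvar s v_nx = size X ->
  uniq X -> {in X, forall x, x < n} ->
  wvar s v_y = y -> y < n -> wvar s v_z = z -> z < n ->
  prog_at s p -> (size p + n).+2 < 4 * n.+1 ^ 2 ->
  elim_at s E -> size E < n ->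
  triple w elim_body s (n * 21 + 30)
    (fun s' => prog_at s' (p ++ elim_row n M X y z) /\ elim_at s' (rcons E (y, z))).
Proof.
move=> sb sX snx uX ltX sy lty sz ltz sp capp sE ltE.
have le_X := small_size uX ltX.
apply: (@triple_seq _ _ _ _ _ (n * 21 + 3) 26); last by lia.
pose ops k : seq instr := [seq (M z x, y, n + x) | x <- take k X & M y x != M z x].
have szops k : size (ops k) <= n.
  by rewrite size_map size_filter (leq_trans (count_size _ _)) // size_take_min geq_min le_X orbT.
apply: (triple_for (b := 18) (I := fun k s' => prog_at s' (p ++ ops k))
    w_gt0 (size_fits uX ltX) _ _ _ snx) => //.
- by rewrite /ops take0 cats0.
- move=> k s' lt_k fr ik Ik; have sb' := base_frame fr isT isT sb.
  have sX' := list_frame fr sX isT.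
  case: fr => fw fa _ _; apply: triple_sem => //; set x := nth 0 X k.
  have ltx : x < n by apply/ltX/mem_nth.
  rewrite /elim_entry; cbn beta iota delta [sem].
  set s1 := set_wvar s' v_x _.
  have sx1 : wvar s1 v_x = x by rewrite /s1 /= /upd /= ik sX'.
  have sy1 : wvar s1 v_y = y by rewrite -sy -(fw v_y).
  have sz1 : wvar s1 v_z = z by rewrite -sz -(fw v_z).
  have sb1 : base s1 by exact: sb'.
  have {}Ik : prog_at s1 (p ++ ops k) by exact: Ik.
  clearbody s1.
  have -> : eval w s1 (Mread v_y v_x =w Mread v_z v_x) = (M y x == M z x).
    cbn beta iota delta [eval eval_op].
    by rewrite !eval_Mread ?sx1 ?sy1 ?sz1 // eqn_bool word_bool.
  have opsS : ops k.+1 = if M y x != M z x then rcons (ops k) (M z x, y, n + x) else ops k.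
    by rewrite /ops (take_nth 0 lt_k) filter_rcons -/x; case: ifP => //; rewrite map_rcons.
  rewrite opsS; case: (M y x =P M z x) => _; first exact: Ik.
  set s2 := set_wvar _ v_src _.
  suff: prog_at (sem w emit s2) (rcons (p ++ ops k) (M z x, y, n + x)).
    by rewrite rcons_cat.
  apply: emit_spec => //.
  + by rewrite size_cat; have := szops k; lia.
  + by rewrite -[LHS]/(eval w s1 (Mread v_z v_x)) eval_Mread ?sx1 ?sz1.
  + by rewrite /= /upd /= (proj1 sb1) sx1 word_small //; nia.
- move=> s' fr; rewrite /ops take_size => Ip.
  have sE' := elim_frame fr isT isT sE; case: fr => fw fa _ _.
  have sy' : wvar s' v_y = y by rewrite fw.
  have sz' : wvar s' v_z = z by rewrite fw.
  apply: triple_sem => //; rewrite /elim_last /elim_row catA cats1.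
  cbn beta iota delta [sem].
  set s1 := set_wvar (set_wvar (set_wvar s' _ _) _ _) _ _.
  have : prog_at (sem w emit s1) (rcons (p ++ ops (size X)) (true, y, z)).
    apply: emit_spec => //.
    + by rewrite /ops take_size.
    + by rewrite size_cat; have := szops (size X); lia.
    + by rewrite /s1 /= /upd /= word_le_n.
  have := sem_frame s1 (isT : straight emit) => fr1.
  have := elim_frame fr1 isT isT (sE' : elim_at s1 E).
  have : wvar (sem w emit s1) v_y = y by case: fr1 => ->.
  have : wvar (sem w emit s1) v_z = z by case: fr1 => ->.
  rewrite /ops take_size; set s2 := sem w emit s1; clearbody s2.
  move=> sz2 sy2 [sne2 sE2] sp2; split; first exact: sp2.
  split=> /=.
    by rewrite /upd /= sne2 (word_le_n (x := 1)) // word_le_n ?addn1 ?size_rcons //; lia.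
  move=> e; rewrite size_rcons ltnS /upd /= sne2 sy2 sz2 nth_rcons => le.
  have [->|ne] := eqVneq e (size E); first by rewrite ltnn.
  have lte : e < size E by rewrite ltn_neqAle ne.
  by rewrite lte sE2.
- by nia.
Qed.

(** Compaction is in place: among the first [k] rows at most [k] survive, so writes stay behind the
    read position and the cells from [k] on still hold the original list. *)
Lemma compact_rows_spec s X Y T p E :
  base s -> list_at s a_X X -> wvar s v_nx = size X ->
  uniq X -> {in X, forall x, x < n} ->
  list_at s a_Y Y -> wvar s v_ny = size Y ->
  uniq Y -> {in Y, forall y, y < n} ->
  {in Y, forall y, warr s a_rep y = rep M T Y y} ->
  prog_at s p -> size p + size Y * n.+1 <= n * n.+2 ->
  elim_at s E -> size E + size Y <= n ->
  triple w compact_rows s (n * (n * 21 + 38) + 7)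
    (fun s' => [/\ wvar s' v_ny = size (reps M T Y), list_at s' a_Y (reps M T Y),
       prog_at s' (p ++ flatten [seq elim_row n M X y (rep M T Y y)
                                | y <- nonreps M T Y]) &
       elim_at s' (E ++ [seq (y, rep M T Y y) | y <- nonreps M T Y])]).
Proof.
move=> sb sX snx uX ltX sY sny uY ltY srep sp capp sE capE.
have le_X := small_size uX ltX; have le_Y := small_size uY ltY.
pose rY k := [seq y <- take k Y | rep M T Y y == y].
pose nY k := [seq y <- take k Y | rep M T Y y != y].
pose ops k : seq instr := flatten [seq elim_row n M X y (rep M T Y y) | y <- nY k].
have szrY k : size (rY k) <= k.
  by rewrite size_filter (leq_trans (count_size _ _)) // size_take_min geq_minl.
have sznY k : size (nY k) <= k.
  by rewrite size_filter (leq_trans (count_size _ _)) // size_take_min geq_minl.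
have szops k : size (ops k) <= k * n.+1.
  apply: (@leq_trans (size (nY k) * n.+1)); last by rewrite leq_mul2r sznY orbT.
  rewrite /ops; elim: (nY k) => //= y N IH; rewrite size_cat mulSn leq_add //.
  rewrite size_cat size_map addn1 ltnS size_filter (leq_trans (count_size _ _)) //.
have rYS k : k < size Y -> let y := nth 0 Y k in
    rY k.+1 = if rep M T Y y == y then rcons (rY k) y else rY k.
  by move=> lt /=; rewrite /rY (take_nth 0 lt) filter_rcons.
have nYS k : k < size Y -> let y := nth 0 Y k in
    nY k.+1 = if rep M T Y y == y then nY k else rcons (nY k) y.
  by move=> lt /=; rewrite /nY (take_nth 0 lt) filter_rcons; case: eqP.
apply: (@triple_seq _ _ _ _ _ 1 (n * (n * 21 + 38) + 5)); last by lia.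
apply: triple_sem => //; set s0 := sem _ _ _.
apply: (@triple_seq _ _ _ _ _ (n * (n * 21 + 38) + 3) 1); last by lia.
apply: (triple_for (b := n * 21 + 35) (I := fun k s' =>
  [/\ wvar s' v_cnt = size (rY k) /\ list_at s' a_Y (rY k),
      forall i, k <= i < size Y -> warr s' a_Y i = nth 0 Y i,
      prog_at s' (p ++ ops k) & elim_at s' (E ++ [seq (y, rep M T Y y) | y <- nY k])])
  w_gt0 (size_fits uY ltY) _ _ _ (sny : wvar s0 v_ny = _)) => //.
- rewrite /rY /ops /nY take0 /= !cats0; split=> //.
  by split=> //; rewrite /= /upd /= /word mod0n.
- move=> k s' lt_k fr ik [[Icnt IrY] IY Ip IE].
  have sb' := base_frame fr isT isT (sb : base s0).
  have sX' := list_frame fr (sX : list_at s0 a_X X) isT.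
  case: fr => fw fa _ _.
  apply: (@triple_seq _ _ _ _ _ 3 (n * 21 + 31)); last by lia.
  apply: triple_sem => //; set s1 := sem _ _ _; set y := nth 0 Y k.
  have Yy : y \in Y by apply: mem_nth.
  have ay : warr s' a_Y k = y by apply: IY; rewrite leqnn.
  have sy1 : wvar s1 v_y = y by rewrite /s1 /= /upd /= /upd /= ik.
  have sz1 : wvar s1 v_z = rep M T Y y.
    by rewrite /s1 /= /upd /= /upd /= ik ay fa // srep.
  have ltz : rep M T Y y < n by apply: ltY; have [] := repP M T Yy.
  have snx1 : wvar s1 v_nx = size X by exact: etrans (fw v_nx isT) snx.
  have {}sb' : base s1 by exact: sb'.
  have {}sX' : list_at s1 a_X X by exact: sX'.
  have {}Icnt : wvar s1 v_cnt = size (rY k) by exact: Icnt.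
  have {}IrY : list_at s1 a_Y (rY k) by exact: IrY.
  have {}IY : forall i, k <= i < size Y -> warr s1 a_Y i = nth 0 Y i by exact: IY.
  have {}Ip : prog_at s1 (p ++ ops k) by exact: Ip.
  have {}IE : elim_at s1 (E ++ [seq (y, rep M T Y y) | y <- nY k]) by exact: IE.
  clearbody s1.
  have ev : eval w s1 (WVar v_y =w WVar v_z) = (rep M T Y y == y).
    by rewrite /= sy1 sz1 eq_sym word_bool.
  apply: (triple_if (b := n * 21 + 30)); rewrite ?ev; last by lia.
    case: (rep M T Y y =P y) => // Ey _; have := rYS k lt_k; have := nYS k lt_k.
    rewrite /= /ops -/y Ey eqxx => -> ->; apply: triple_sem => //=; first by lia.
    have sz := szrY k; split=> //.
      split.
        rewrite /= /upd /= Icnt (word_le_n (x := 1)) // word_le_n ?addn1 //; last by lia.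
        by rewrite size_rcons.
      move=> i; rewrite size_rcons ltnS /= /upd /= Icnt sy1 nth_rcons => le.
      have [->|ne] := eqVneq i (size (rY k)); first by rewrite ltnn.
      have lt : i < size (rY k) by rewrite ltn_neqAle ne.
      by rewrite lt IrY.
    move=> i /andP[lti lt]; rewrite /= /upd /= Icnt ifN; last by rewrite neq_ltn; lia.
    by apply: IY; rewrite ltnW.
  case: (rep M T Y y =P y) => // /eqP Ey _; have := rYS k lt_k; have := nYS k lt_k.
  rewrite /= -/y (negPf Ey) => nE ->.
  have := elim_body_spec sb' sX' snx1 uX ltX sy1 (ltY y Yy) sz1 ltz Ip _ IE _.
  have capk : k * n.+1 + n.+1 <= size Y * n.+1 by rewrite -mulSnr leq_mul2r lt_k orbT.
  have -> : (size (p ++ ops k) + n).+2 < 4 * n.+1 ^ 2.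
    by rewrite size_cat; have := szops k; nia.
  have -> : size (E ++ [seq (y0, rep M T Y y0) | y0 <- nY k]) < n.
    by rewrite size_cat size_map; have := sznY k; lia.
  move=> /(_ isT isT) /triple_conseq; apply=> // s2 [fw2 fa2 _ _] [Ip2 IE2].
  split.
  + by split; [rewrite -Icnt -(fw2 v_cnt) | move=> i lt; rewrite /= fa2 // IrY].
  + by move=> i /andP[lti lt]; rewrite /= fa2 // IY // ltnW.
  + by rewrite /ops nE map_rcons flatten_rcons catA; exact: Ip2.
  + by rewrite nE map_rcons -rcons_cat; exact: IE2.
- move=> s' _; rewrite /rY /ops /nY take_size => -[[Icnt IrY] _ Ip IE].
  by apply: triple_sem => //; split.
- by nia.
Qed.

Lemma refine_cols_spec s X Y :
  base s -> list_at s a_X X -> wvar s v_nx = size X ->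
  uniq X -> {in X, forall x, x < n} ->
  list_at s a_Y Y -> wvar s v_ny = size Y ->
  uniq Y -> {in Y, forall y, y < n} ->
  {in X, forall x, warr s a_rep x = rep M [::] X x} ->
  triple w refine_cols s (n * (n * 18 + 12) + 3)
    (fun s' => {in X, forall x, warr s' a_rep x = rep M Y X x}).
Proof.
move=> sb sX snx uX ltX sY sny uY ltY srep; have le_Y := small_size uY ltY.
apply: (triple_for (b := n * 18 + 9) (I := fun k s' =>
    {in X, forall x, warr s' a_rep x = rep M (take k Y) X x})
    w_gt0 (size_fits uY ltY) _ _ _ sny) => //.
- by rewrite take0.
- move=> k s' lt_k fr ik Ik; have sb' := base_frame fr isT isT sb.
  have sX' := list_frame fr sX isT; have sY' := list_frame fr sY isT.
  have snx' : wvar s' v_nx = size X by case: fr => ->.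
  apply: (@triple_seq _ _ _ _ _ 1 (n * 18 + 7)); last by lia.
  apply: triple_sem => //=; rewrite (take_nth 0 lt_k).
  apply: (triple_conseq (refine_spec (s := set_wvar s' v_t _) (len := v_nx)
    (t := nth 0 Y k) _ _ _ sX' snx' uX ltX _ _ Ik)) => //=.
  + by rewrite /upd /= ik sY'.
  + exact/ltY/mem_nth.
- by move=> s' _; rewrite take_size.
- by nia.
Qed.

Lemma compact_cols_spec s X Y p :
  base s -> list_at s a_X X -> wvar s v_nx = size X ->
  uniq X -> {in X, forall x, x < n} ->
  {in X, forall x, warr s a_rep x = rep M Y X x} ->
  prog_at s p -> size p + size X <= n * n.+2 ->
  triple w compact_cols s (n * 30 + 7)
    (fun s' => [/\ wvar s' v_nx = size (reps M Y X), list_at s' a_X (reps M Y X) &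
       prog_at s' (p ++ [seq (false, n + rep M Y X x, n + x) | x <- nonreps M Y X])]).
Proof.
move=> sb sX snx uX ltX srep sp capp.
have le_X := small_size uX ltX.
pose rX k := [seq y <- take k X | rep M Y X y == y].
pose nX k := [seq y <- take k X | rep M Y X y != y].
pose ops k : seq instr := [seq (false, n + rep M Y X x, n + x) | x <- nX k].
have szrX k : size (rX k) <= k.
  by rewrite size_filter (leq_trans (count_size _ _)) // size_take_min geq_minl.
have szops k : size (ops k) <= k.
  by rewrite size_map size_filter (leq_trans (count_size _ _)) // size_take_min geq_minl.
have rXS k : k < size X -> let y := nth 0 X k in
    rX k.+1 = if rep M Y X y == y then rcons (rX k) y else rX k.
  by move=> lt /=; rewrite /rX (take_nth 0 lt) filter_rcons.
have nXS k : k < size X -> let y := nth 0 X k in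
    nX k.+1 = if rep M Y X y == y then nX k else rcons (nX k) y.
  by move=> lt /=; rewrite /nX (take_nth 0 lt) filter_rcons; case: eqP.
apply: (@triple_seq _ _ _ _ _ 1 (n * 30 + 5)); last by lia.
apply: triple_sem => //; set s0 := sem _ _ _.
apply: (@triple_seq _ _ _ _ _ (n * 30 + 3) 1); last by lia.
apply: (triple_for (b := 27) (I := fun k s' =>
  [/\ wvar s' v_cnt = size (rX k), list_at s' a_X (rX k),
      forall i, k <= i < size X -> warr s' a_X i = nth 0 X i &
      prog_at s' (p ++ ops k)])
  w_gt0 (size_fits uX ltX) _ _ _ (snx : wvar s0 v_nx = _)) => //.
- rewrite /rX /ops /nX take0 /= !cats0; split=> //.
  by rewrite /= /upd /= /word mod0n.
- move=> k s' lt_k fr ik [Icnt IrX IX Ip].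
  have sn' := proj1 (base_frame fr isT isT (sb : base s0)).
  case: fr => fw fa _ _.
  apply: triple_sem => //; cbn beta iota delta [sem].
  set s1 := set_wvar (set_wvar s' _ _) _ _; set x := nth 0 X k.
  have Xx : x \in X by apply: mem_nth.
  have ax : warr s' a_X k = x by apply: IX; rewrite leqnn.
  have sx1 : wvar s1 v_x = x by rewrite /s1 /= /upd /= /upd /= ik.
  have sz1 : wvar s1 v_z = rep M Y X x.
    by rewrite /s1 /= /upd /= /upd /= ik ax fa // srep.
  have ltz : rep M Y X x < n by apply: ltX; have [] := repP M Y Xx.
  have ltx := ltX x Xx.
  have {}sn' : wvar s1 v_n = n by exact: sn'.
  have {}Icnt : wvar s1 v_cnt = size (rX k) by exact: Icnt.
  have {}IrX : list_at s1 a_X (rX k) by exact: IrX.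
  have {}IX : forall i, k <= i < size X -> warr s1 a_X i = nth 0 X i by exact: IX.
  have {}Ip : prog_at s1 (p ++ ops k) by exact: Ip.
  clearbody s1.
  have -> : eval w s1 (WVar v_x =w WVar v_z) = (rep M Y X x == x).
    by rewrite /= sx1 sz1 eq_sym word_bool.
  have := rXS k lt_k; have := nXS k lt_k; rewrite /= -/x.
  case: (rep M Y X x =P x) => Ex nE -> /=.
    rewrite /ops nE -/(ops k); have sz := szrX k; split=> //.
    + by rewrite /= /upd /= Icnt (word_le_n (x := 1)) // word_le_n ?addn1 ?size_rcons //; lia.
    + move=> i; rewrite size_rcons ltnS /= /upd /= Icnt sx1 nth_rcons => le.
      have [->|ne] := eqVneq i (size (rX k)); first by rewrite ltnn.
      have lt : i < size (rX k) by rewrite ltn_neqAle ne.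
      by rewrite lt IrX.
    + move=> i /andP[lti lt]; rewrite /= /upd /= Icnt ifN; last by rewrite neq_ltn; lia.
      by apply: IX; rewrite ltnW.
  set s2 := set_wvar _ v_src _.
  have : prog_at (sem w emit s2) (rcons (p ++ ops k) (false, n + rep M Y X x, n + x)).
    apply: emit_spec => //.
    + by rewrite size_cat; have := szops k; nia.
    + by rewrite /= /upd /= /word mod0n.
    + by rewrite /= /upd /= sn' sz1 word_small //; nia.
    + by rewrite /= /upd /= sn' sx1 word_small //; nia.
  have [fw2 fa2 _ _] := sem_frame s2 (isT : straight emit).
  move=> Ip2; split.
  + by rewrite -Icnt; exact: (fw2 v_cnt).
  + by move=> i lt; rewrite -IrX //; exact: (congr1 (fun f => f i) (fa2 a_X isT)).
  + move=> i /andP[lti lt]; rewrite -IX; last by rewrite ltnW.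
    exact: (congr1 (fun f => f i) (fa2 a_X isT)).
  + by rewrite /ops nE map_rcons -rcons_cat; exact: Ip2.
- move=> s' _; rewrite /rX /ops /nX take_size => -[Icnt IrX _ Ip].
  by apply: triple_sem => //; split.
- by nia.
Qed.

Definition work_at s Z : Prop :=
  [/\ base s, list_at s a_Y (rows Z) /\ wvar s v_ny = size (rows Z),
      list_at s a_X (cols Z) /\ wvar s v_nx = size (cols Z),
      prog_at s (prog Z) & elim_at s (elim Z)].

Lemma size_reps T l : size (reps M T l) + size (nonreps M T l) = size l.
Proof. by rewrite -size_cat; apply/perm_size/perm_reps. Qed.

(** Two rows differ on at most [n] columns whatever the coins. This deterministic bound keeps the
    instruction list within the word range even for bad samples. *)
Lemma potential_phase_n T Z : work_ok n Z ->
  potential n (phase n M T Z) <= potential n Z.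
Proof.
case=> _ uX ltX _; apply: potential_phase => y _.
by rewrite (leq_trans (count_size _ _)) // small_size.
Qed.

Lemma work_ok_elim_size Z : work_ok n Z -> size (elim Z) + size (rows Z) = n.
Proof.
case=> /perm_size + _ _ _; rewrite size_cat size_map size_iota => <-.
by rewrite addnC.
Qed.

(** Quadratic for all coins: rows and columns are refined at most [n] times each, every refinement
    and every eliminated row costs O(n). *)
Lemma phase_spec s Z cs ph :
  work_ok n Z -> work_at s Z -> potential n Z <= n * n.+2 ->
  wvar s v_ph = ph -> ph < n ->
  (forall g, g < n ->
     warr s a_rnd (ph * n + g) = bits_val j 0 (drop (g * j) cs)) ->
  triple w (phase_cmd j) s (120 * n.+1 ^ 2)
    (fun s' => work_at s' (random_phase n j M cs Z)).
Proof.
move=> okZ [sb [sY sny] [sX snx] sp sE] pot sph ltph srnd.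
have [uY ltY] := work_ok_rows okZ.
have szE := work_ok_elim_size okZ.
have := potential_phase_n (sample j (cols Z) cs n) okZ.
rewrite -/(random_phase n j M cs Z).
case: (okZ) => _ uX ltX _.
rewrite {1}/potential /random_phase /=; set T := sample _ _ _ _.
set Y := rows Z in uY ltY sY sny szE *; set X := cols Z in T uX ltX sX snx *.
set Y' := reps M T Y; rewrite !size_cat size_map => pot'.
have uY' : uniq Y' by rewrite filter_uniq.
have ltY' : {in Y', forall y, y < n} by move=> y /mem_reps/ltY.
have := size_reps Y' X => szX.
pose c1 := n * 4 + 3; pose c2 := n * (n * 18 + 15) + 3.
pose c3 := n * (n * 21 + 38) + 7; pose c5 := n * (n * 18 + 12) + 3.
pose c6 := n * 30 + 7.
pose d5 := (c5 + c6).+1; pose d4 := (c1 + d5).+1; pose d3 := (c3 + d4).+1.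
apply: (@triple_seq _ _ _ _ _ c1 (c2 + d3).+1);
  last by rewrite /d3 /d4 /d5 /c1 /c2 /c3 /c5 /c6; nia.
apply: (triple_conseq (init_reps_spec (s := s) (a := a_Y) (len := v_ny)
  _ _ sY sny uY ltY)) => //.
move=> s1 fr1 rep1.
have sb1 := base_frame fr1 isT isT sb; have sX1 := list_frame fr1 sX isT.
have sY1 := list_frame fr1 sY isT; have sp1 := prog_frame fr1 isT isT sp.
have sE1 := elim_frame fr1 isT isT sE.
have [snx1 sny1 sph1] : [/\ wvar s1 v_nx = size X, wvar s1 v_ny = size Y & wvar s1 v_ph = ph].
  by case: fr1 => fw _ _ _; rewrite !fw.
have srnd1 : forall g, g < n -> warr s1 a_rnd (ph * n + g) = bits_val j 0 (drop (g * j) cs).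
  by case: fr1 => _ -> // _ _.
apply: (@triple_seq _ _ _ _ _ c2 d3) => //.
apply: (triple_conseq (sample_rows_spec sb1 sX1 snx1 uX ltX sY1 sny1 uY ltY
  sph1 ltph srnd1 rep1)) => //.
move=> s2 fr2 rep2; move: fr2; rewrite -/T in rep2 * => fr2.
have sb2 := base_frame fr2 isT isT sb1; have sX2 := list_frame fr2 sX1 isT.
have sY2 := list_frame fr2 sY1 isT; have sp2 := prog_frame fr2 isT isT sp1.
have sE2 := elim_frame fr2 isT isT sE1.
have [snx2 sny2] : wvar s2 v_nx = size X /\ wvar s2 v_ny = size Y.
  by case: fr2 => fw _ _ _; rewrite !fw.
apply: (@triple_seq _ _ _ _ _ c3 d4) => //.
have capp : size (prog Z) + size Y * n.+1 <= n * n.+2.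
  by move: pot; rewrite /potential -/Y; lia.
have capE : size (elim Z) + size Y <= n by rewrite szE.
apply: (triple_conseq (compact_rows_spec sb2 sX2 snx2 uX ltX sY2 sny2 uY ltY
  rep2 sp2 capp sE2 capE)) => //.
move=> s3 fr3 [sny3 sY3 sp3 sE3].
have sb3 := base_frame fr3 isT isT sb2; have sX3 := list_frame fr3 sX2 isT.
have snx3 : wvar s3 v_nx = size X by case: fr3 => ->.
apply: (@triple_seq _ _ _ _ _ c1 d5) => //.
apply: (triple_conseq (init_reps_spec (s := s3) (a := a_X) (len := v_nx)
  _ _ sX3 snx3 uX ltX)) => //.
move=> s4 fr4 rep4.
have sb4 := base_frame fr4 isT isT sb3; have sX4 := list_frame fr4 sX3 isT.
have sY4 := list_frame fr4 sY3 isT; have sp4 := prog_frame fr4 isT isT sp3.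
have sE4 := elim_frame fr4 isT isT sE3.
have [snx4 sny4] : wvar s4 v_nx = size X /\ wvar s4 v_ny = size Y'.
  by case: fr4 => fw _ _ _; rewrite !fw.
apply: (@triple_seq _ _ _ _ _ c5 c6) => //.
apply: (triple_conseq (refine_cols_spec sb4 sX4 snx4 uX ltX sY4 sny4 uY' ltY' rep4)) => //.
move=> s5 fr5 rep5.
have sb5 := base_frame fr5 isT isT sb4; have sX5 := list_frame fr5 sX4 isT.
have sY5 := list_frame fr5 sY4 isT; have sp5 := prog_frame fr5 isT isT sp4.
have sE5 := elim_frame fr5 isT isT sE4.
have [snx5 sny5] : wvar s5 v_nx = size X /\ wvar s5 v_ny = size Y'.
  by case: fr5 => fw _ _ _; rewrite !fw.
(* Each column will either remain or cost one instruction, so this sum is dominated by the potential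
   after the phase. *)
have capp5 : size (prog Z ++ flatten [seq elim_row n M X y (rep M T Y y)
                        | y <- nonreps M T Y]) + size X <= n * n.+2.
  rewrite size_cat -szX; apply: leq_trans pot.
  by apply: leq_trans pot'; rewrite -/Y; lia.
apply: (triple_conseq (compact_cols_spec sb5 sX5 snx5 uX ltX rep5 sp5 capp5)) => //.
move=> s6 fr6 [snx6 sX6 sp6].
split=> //.
- exact: base_frame fr6 isT isT sb5.
- split; first exact: list_frame fr6 sY5 isT.
  by case: fr6 => ->.
- exact: elim_frame fr6 isT isT sE5.
Qed.

Lemma potential_random_phases_n L cs Z : work_ok n Z ->
  potential n (random_phases n j M L cs Z) <= potential n Z.
Proof.
elim: L cs Z => //= L IH cs Z okZ; apply: leq_trans (potential_phase_n _ okZ).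
exact/IH/work_ok_phase.
Qed.

Lemma phases_spec s L cs : L <= n -> wvar s v_L = L -> work_at s (start n) ->
  (forall q, q < L * n -> warr s a_rnd q = bits_val j 0 (drop (q * j) cs)) ->
  triple w (For v_ph v_L (phase_cmd j)) s (L * (120 * n.+1 ^ 2 + 3) + 3)
    (fun s' => work_at s' (random_phases n j M L cs (start n))).
Proof.
move=> leL sL sZ srnd.
have ltLw : L < 2 ^ w by have := cap4; nia.
have ok0 := work_ok_start n.
apply: (triple_for (b := 120 * n.+1 ^ 2) (I := fun k s' =>
  work_at s' (random_phases n j M k cs (start n))) w_gt0 ltLw _ _ _ sL) => //.
move=> k s' lt_k fr ik Ik; rewrite random_phasesS.
have pot : potential n (random_phases n j M k cs (start n)) <= n * n.+2.
  apply: leq_trans (potential_random_phases_n _ _ ok0) _.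
  by rewrite /potential /= size_iota; lia.
apply: (triple_conseq (phase_spec (cs := drop (k * (n * j)) cs)
  (work_ok_random_phases _ _ _ _ ok0) Ik pot ik (leq_trans lt_k leL) _)) => //.
move=> g lt_g; case: fr => _ -> // _ _; rewrite srnd; last by nia.
by rewrite drop_drop; congr (bits_val _ _ (drop _ _)); lia.
Qed.

(** [n] iterations suffice, since [l <= 2 ^ (l - 1) <= n]; afterwards both variables stay constant,
    whence the [minn]. *)
Lemma count_phases_spec s : 0 < n -> wvar s v_n = n -> wvar s v_L = 0 ->
  triple w count_phases s (n * 9 + 7)
    (fun s' => wvar s' v_L = (trunc_log 2 n).+1
               /\ wvar s' v_LN = (trunc_log 2 n).+1 * n).
Proof.
move=> n0 sn sL; set l := (trunc_log 2 n).+1.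
have [ltl leP] : 2 ^ l.-1 <= n /\ n < 2 ^ l.
  by have /andP[] := trunc_log_bounds (isT : 1 < 2) n0.
have le_ln : l <= n by apply: leq_trans ltl; rewrite /l /= ltn_expl.
have ltn_w : n < 2 ^ w by have := cap4; nia.
apply: (@triple_seq _ _ _ _ _ 1 (n * 9 + 5)); last by lia.
apply: triple_sem => //; set s0 := sem _ _ _.
apply: (@triple_seq _ _ _ _ _ (n * 9 + 3) 1); last by lia.
apply: (triple_for (b := 5) (I := fun k s' =>
  wvar s' v_p = 2 ^ minn k l /\ wvar s' v_L = minn k l)
  w_gt0 ltn_w _ _ _ (sn : wvar s0 v_n = n)) => //.
- by rewrite min0n; split; rewrite //= /upd /= word_le_n.
- move=> k s' lt_k [fw _ _ _] ik [Ip IL]; apply: triple_sem => //.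
  cbn beta iota delta [sem].
  have -> : eval w s' (WVar v_n <w WVar v_p) = (l <= k).
    have sn' : wvar s' v_n = n by exact: etrans (fw v_n isT) sn.
    rewrite /= Ip sn' word_bool; congr nat_of_bool.
    have [le|lt] := leqP l k; first by rewrite leP.
    apply/negbTE; rewrite -leqNgt.
    by apply: leq_trans ltl; rewrite leq_exp2l.
  case: (boolP (l <= k)) => [le|] /=.
    by rewrite /upd /= Ip IL (minn_idPr le) (minn_idPr (leqW le)).
  rewrite -ltnNge => lt.
  rewrite /upd /= Ip IL (minn_idPl (ltnW lt)) (minn_idPl lt) addnn -mul2n -expnS.
  have le2 : 2 ^ k.+1 <= 2 * n.
    by rewrite expnS leq_mul2l /=; apply: leq_trans ltl; rewrite leq_exp2l.
  rewrite (word_le_n (x := 1)) // addn1 word_small; last by nia.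
  by rewrite word_le_n //; lia.
- move=> s' [fw _ _ _] [_]; rewrite (minn_idPr le_ln) => IL; apply: triple_sem => //=.
  have sn' : wvar s' v_n = n by exact: etrans (fw v_n isT) sn.
  by rewrite /upd /= IL sn' word_small //; nia.
- by lia.
Qed.

Lemma straight_flips m : straight (flips m).
Proof. by elim: m => //= m ->. Qed.

Lemma cost_flips m : cost (flips m) = 4 * m + 1.
Proof. by elim: m => //= m ->; lia. Qed.

Lemma flips_mods m : (wmods (flips m) = flatten (nseq m [:: v_coin; v_r]))
  /\ amods (flips m) = [::] /\ gmods (flips m) = [::].
Proof. by elim: m => //= m [-> [-> ->]]. Qed.

Lemma flips_notin m x : x != v_coin -> x != v_r -> x \notin wmods (flips m).
Proof.
move=> h1 h2; rewrite (proj1 (flips_mods m)); elim: m => //= m IH.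
by rewrite !inE !negb_or h1 h2.
Qed.

Lemma flips_spec s m r : wvar s v_r = r -> r.+1 * 2 ^ m <= 2 ^ w ->
  wvar (sem w (flips m) s) v_r = bits_val m r (coins s)
  /\ coins (sem w (flips m) s) = drop m (coins s).
Proof.
elim: m s r => [|m IH] s r sr cap; first by rewrite drop0.
have word_id x : x < 2 ^ w -> word w x = x by exact: modn_small.
cbn beta iota delta [flips sem]; set s1 := set_wvar _ _ _.
have P0 : 0 < 2 ^ m by rewrite expn_gt0.
have w2 : 2 < 2 ^ w by have := cap4; nia.
move: cap; rewrite expnS => cap.
have lt_r : 2 * r + 1 < 2 ^ w by nia.
have bd : (head false (coins s) : nat) <= 1 by case: (head _ _).
have sr1 : wvar s1 v_r = 2 * r + head false (coins s).
  by rewrite /s1 /= /upd /= sr word_bool (word_id 2) // (word_id (2 * r)) ?word_id //; lia.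
have [|-> ->] := IH s1 _ sr1; first by nia.
by rewrite /s1 /=; case: (coins s).
Qed.

Lemma toss_spec s L cs : L <= n -> wvar s v_LN = L * n -> coins s = cs ->
  triple w (toss j) s (L * n * (4 * j + 8) + 3)
    (fun s' => forall q, q < L * n -> warr s' a_rnd q = bits_val j 0 (drop (q * j) cs)).
Proof.
move=> leL sLN scs.
have ltw : L * n < 2 ^ w by have := cap4; nia.
have [_ [am gm]] := flips_mods j.
apply: (triple_for (b := 4 * j + 5) (I := fun k s' => coins s' = drop (k * j) cs
  /\ forall q, q < k -> warr s' a_rnd q = bits_val j 0 (drop (q * j) cs))
  w_gt0 ltw _ _ _ sLN) => //.
- by rewrite /= inE cats0 negb_or flips_notin.
- by rewrite /= inE cats0 negb_or flips_notin.
- by rewrite mul0n drop0; split.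
- move=> k s' lt_k _ ik [Ic Ir]; apply: triple_sem.
  + by rewrite /= straight_flips.
  + by rewrite /= cost_flips; lia.
  cbn beta iota delta [sem]; set s1 := set_wvar s' _ _.
  have sr1 : wvar s1 v_r = 0 by rewrite /s1 /= /upd /= word_le_n.
  have cap1 : 1 * 2 ^ j <= 2 ^ w.
    by rewrite mul1n; apply: leq_trans capacity; rewrite leq_pmulr //; nia.
  have [sr2 sc2] := flips_spec sr1 cap1.
  have [fw2 fa2 _ _] := sem_frame s1 (straight_flips j).
  split; first by rewrite /= sc2 /= Ic drop_drop -mulSn.
  move=> q; rewrite ltnS /= /upd /= sr2 /= Ic fw2 ?flips_notin //= /upd /= ik.
  case: eqP => [-> //|/eqP ne] le; rewrite fa2 ?am //= Ir //.
  by rewrite ltn_neqAle ne.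
- by move=> s' _ [].
- by lia.
Qed.

Lemma init_lists_spec s : wvar s v_n = n ->
  triple w init_lists s (n * 6 + 7)
    (fun s' => [/\ list_at s' a_Y (iota 0 n) /\ wvar s' v_ny = n &
                    list_at s' a_X (iota 0 n) /\ wvar s' v_nx = n]).
Proof.
move=> sn; have ltn_w : n < 2 ^ w by have := cap4; nia.
apply: (@triple_seq _ _ _ _ _ (n * 6 + 3) 3); last by lia.
apply: (triple_for (b := 3) (I := fun k s' => forall i, i < k ->
  warr s' a_Y i = i /\ warr s' a_X i = i) w_gt0 ltn_w _ _ _ sn) => //.
- move=> k s' lt_k _ ik Ik; apply: triple_sem => // i; rewrite ltnS => le.
  rewrite /= /upd /= ik; case: eqP => [-> //|/eqP ne].
  by apply: Ik; rewrite ltn_neqAle ne.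
- move=> s' [fw _ _ _] In; have sn' : wvar s' v_n = n by rewrite fw.
  apply: triple_sem => //; split; split=> //=.
  + by move=> i; rewrite size_iota => lt; rewrite nth_iota // (proj1 (In i lt)).
  + by move=> i; rewrite size_iota => lt; rewrite nth_iota // (proj2 (In i lt)).
Qed.

Lemma eq_cell a b c i : c < n -> i < n ->
  (a * n + c == b * n + i) = (a == b) && (c == i).
Proof.
move=> ltc lti; apply/eqP/andP => [E|[/eqP -> /eqP -> //]].
have n0 : 0 < n by apply: leq_ltn_trans ltc.
have := congr1 (divn^~ n) E; have := congr1 (modn^~ n) E.
by rewrite /= !modnMDl !divnMDl // !modn_small // !divn_small // !addn0 => -> ->.
Qed.

Lemma copy_input_spec s : wvar s v_n = n ->
  triple w copy_input s (n * (n * 4 + 6) + 3)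
    (fun s' => forall a c, c < n -> garr s' 1 (a * n + c) =
       if n <= a < n + n then garr s 0 ((a - n) * n + c) else garr s 1 (a * n + c)).
Proof.
move=> sn; have ltn_w : n < 2 ^ w by have := cap4; nia.
apply: (triple_for (b := n * 4 + 3) (I := fun k s' => forall a c, c < n ->
  garr s' 1 (a * n + c) = if n <= a < n + k then garr s 0 ((a - n) * n + c)
                          else garr s 1 (a * n + c)) w_gt0 ltn_w _ _ _ sn) => //.
- by move=> a c _; rewrite addn0 leqNgt; case: ltnP => //; rewrite ?andbF.
- move=> k s1 lt_k fr1 ik Ik.
  have sn1 : wvar s1 v_n = n by case: fr1 => ->.
  have g1 : garr s1 0 = garr s 0 by case: fr1 => _ _ ->.
  apply: (triple_for (b := 1) (I := fun i s' => forall a c, c < n ->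
    garr s' 1 (a * n + c) =
      if (n <= a < n + k) || (a == n + k) && (c < i)
      then garr s 0 ((a - n) * n + c) else garr s 1 (a * n + c))
    w_gt0 ltn_w _ _ _ sn1) => //.
  + by move=> a c ltc; rewrite ltn0 andbF orbF; apply: Ik.
  + move=> i s2 lt_i [fw2 _ fg2 _] ii Ii; apply: triple_sem => // a c ltc.
    rewrite /= /upd /= ii !(fw2 v_g) // ik !(fw2 v_n) // sn1.
    rewrite (word_small (x := n + k)); last by nia.
    rewrite (word_small (x := (n + k) * n)); last by nia.
    rewrite (word_small (x := (n + k) * n + i)); last by nia.
    rewrite (word_small (x := k * n)); last by nia.
    rewrite (word_small (x := k * n + i)); last by nia.
    rewrite eq_cell // (ltnS c) (leq_eqVlt c) fg2 // g1 Ii //.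
    case: (a =P n + k) => [->|_] //=; rewrite addKn.
    by case: (c =P i) => [->|_] //=; rewrite orbT.
  + move=> s2 _ In a c ltc; rewrite /= In // ltc andbT addnS ltnS.
    congr (if _ then _ else _); apply/idP/idP.
      by case/orP => [/andP[-> /ltnW ->]|/eqP ->]; rewrite ?leq_addr ?leqnn.
    by case/andP => ->; rewrite leq_eqVlt orbC => ->.
- by lia.
Qed.

Lemma size_brute_force X Y : size (brute_force n M X Y) <= size Y * size X.
Proof.
rewrite /brute_force; elim: Y => //= y Y IH.
by rewrite size_cat mulSn leq_add // size_map size_filter count_size.
Qed.

Lemma brute_force_spec s X Y p :
  base s -> list_at s a_X X -> wvar s v_nx = size X ->
  uniq X -> {in X, forall x, x < n} ->
  list_at s a_Y Y -> wvar s v_ny = size Y ->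
  uniq Y -> {in Y, forall y, y < n} ->
  prog_at s p -> size p <= n * n.+2 ->
  triple w brute_force_cmd s (n * (n * 20 + 8) + 3)
    (fun s' => prog_at s' (p ++ brute_force n M X Y)).
Proof.
move=> sb sX snx uX ltX sY sny uY ltY sp capp.
have le_X := small_size uX ltX; have le_Y := small_size uY ltY.
apply: (triple_for (b := n * 20 + 5) (I := fun k s' =>
  prog_at s' (p ++ brute_force n M X (take k Y)))
  w_gt0 (size_fits uY ltY) _ _ _ sny) => //.
- by rewrite take0 cats0.
- move=> k s' lt_k fr ik Ik; have sb' := base_frame fr isT isT sb.
  have sX' := list_frame fr sX isT; have sY' := list_frame fr sY isT.
  have snx' : wvar s' v_nx = size X by case: fr => ->.
  apply: (@triple_seq _ _ _ _ _ 1 (n * 20 + 3)); last by lia.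
  apply: triple_sem => //; set s1 := sem _ _ _; set y := nth 0 Y k.
  have lty : y < n by apply/ltY/mem_nth.
  have sy1 : wvar s1 v_y = y by rewrite /s1 /= /upd /= ik sY'.
  rewrite (take_nth 0 lt_k) /brute_force map_rcons flatten_rcons -/y.
  rewrite -/(brute_force n M X (take k Y)) catA.
  set q := p ++ _ in Ik *.
  have szq : size q <= n * n.+2 + n * n.
    rewrite size_cat leq_add // (leq_trans (size_brute_force _ _)) //.
    by rewrite leq_mul // size_take_min geq_min le_Y orbT.
  pose ops i : seq instr := [seq (false, y, n + x) | x <- take i X & M y x].
  have szops i : size (ops i) <= n.
    by rewrite size_map size_filter (leq_trans (count_size _ _)) // size_take_min geq_min le_X orbT.
  apply: (triple_for (b := 17) (I := fun i s' => prog_at s' (q ++ ops i))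
    w_gt0 (size_fits uX ltX) _ _ _ (snx' : wvar s1 v_nx = _)) => //.
  + by rewrite /ops take0 cats0.
  + move=> i s2 lt_i fr2 ii Ii.
    have sb2 := base_frame fr2 isT isT (sb' : base s1).
    have sX2 := list_frame fr2 (sX' : list_at s1 a_X X) isT.
    have sy2 : wvar s2 v_y = y by case: fr2 => ->.
    apply: triple_sem => //; set x := nth 0 X i.
    have ltx : x < n by apply/ltX/mem_nth.
    cbn beta iota delta [sem]; set s3 := set_wvar s2 v_x _.
    have sx3 : wvar s3 v_x = x by rewrite /s3 /= /upd /= ii sX2.
    have sy3 : wvar s3 v_y = y by exact: sy2.
    have sb3 : base s3 by exact: sb2.
    have {}Ii : prog_at s3 (q ++ ops i) by exact: Ii.
    clearbody s3.
    rewrite eval_Mread ?sx3 ?sy3 //.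
    have opsS : ops i.+1 = if M y x then rcons (ops i) (false, y, n + x) else ops i.
      by rewrite /ops (take_nth 0 lt_i) filter_rcons -/x; case: ifP => //; rewrite map_rcons.
    rewrite opsS; case: (M y x); last exact: Ii.
    set s4 := set_wvar _ v_src _.
    suff: prog_at (sem w emit s4) (rcons (q ++ ops i) (false, y, n + x)).
      by rewrite rcons_cat.
    apply: emit_spec => //.
    * by rewrite size_cat; have := szops i; nia.
    * by rewrite /= /upd /= /word mod0n.
    * by rewrite /= /upd /= (proj1 sb3) sx3 word_small //; nia.
  + by move=> s2 _; rewrite /ops take_size.
  + by nia.
- by move=> s' _; rewrite take_size.
- by nia.
Qed.

Lemma back_substitution_spec s E p :
  elim_at s E -> size E <= n -> prog_at s p -> size p <= n * n.+2 + n * n ->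
  triple w back_substitution_cmd s (n * 16 + 3)
    (fun s' => prog_at s' (p ++ back_substitution E)).
Proof.
move=> sE leE sp capp; have ltEw : size E < 2 ^ w by have := cap4; nia.
pose ops k : seq instr := [seq (false, q.1, q.2) | q <- take k (rev E)].
have szops k : size (ops k) <= size E.
  by rewrite size_map size_take_min geq_min size_rev leqnn orbT.
apply: (triple_for (b := 13) (I := fun k s' => prog_at s' (p ++ ops k))
  w_gt0 ltEw _ _ _ (proj1 sE)) => //.
- by rewrite /ops take0 cats0.
- move=> k s' lt_k fr ik Ik; have [sne' sE'] := elim_frame fr isT isT sE.
  apply: triple_sem => //; cbn beta iota delta [sem].
  set s1 := set_wvar _ v_src _.
  have opsS : ops k.+1 = rcons (ops k) (false, (nth (0, 0) E (size E - k.+1)).1,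
                                        (nth (0, 0) E (size E - k.+1)).2).
    by rewrite /ops (take_nth (0, 0)) ?size_rev // map_rcons nth_rev.
  have lt1 : size E - k.+1 < size E by lia.
  have idx : word w (size E - word w (k + word w 1)) = size E - k.+1.
    by rewrite (word_le_n (x := 1)) // addn1 !word_le_n //; lia.
  suff: prog_at (sem w emit s1) (rcons (p ++ ops k)
      (false, (nth (0, 0) E (size E - k.+1)).1, (nth (0, 0) E (size E - k.+1)).2)).
    by rewrite opsS rcons_cat.
  have := sE' _ lt1 => /(congr1 (fun q => (q.1, q.2))) /= [e1 e2].
  apply: emit_spec => //.
  + by rewrite size_cat; have := szops k; nia.
  + by rewrite /= /upd /= /word mod0n.
  + by rewrite /= /upd /= ik sne' idx.
  + by rewrite /= /upd /= ik sne' idx.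
- by move=> s' _; rewrite /ops take_oversize // size_rev.
- by nia.
Qed.

Definition valid_instr (i : instr) : bool := (i.1.2 < n + n) && (i.2 < n + n).

(** Each coordinate [c] evolves as an independent scalar register machine; the inner loop advances
    one coordinate at a time. [valid_instr] keeps the cell indices below [2 * n * n]. *)
Lemma interpreter_spec s p : wvar s v_n = n -> prog_at s p ->
  size p < 4 * n.+1 ^ 2 -> all valid_instr p ->
  triple w interpreter s (size p * (n * 6 + 6) + 3)
    (fun s' => forall a c, c < n ->
       garr s' 1 (a * n + c) = exec (fun a => garr s 1 (a * n + c)) p a).
Proof.
move=> sn [sm sp] ltp valp; have ltn_w : n < 2 ^ w by have := cap4; nia.
have ltpw : size p < 2 ^ w by apply: leq_trans cap4.
apply: (triple_for (b := n * 6 + 3) (I := fun k s' => forall a c, c < n ->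
  garr s' 1 (a * n + c) = exec (fun a => garr s 1 (a * n + c)) (take k p) a)
  w_gt0 ltpw _ _ _ sm) => //.
- by move=> a c _; rewrite take0.
- move=> k s1 lt_k fr1 ik Ik.
  have sn1 : wvar s1 v_n = n by case: fr1 => ->.
  have := sp k lt_k; case Ei : (nth _ p k) => [[sg a0] b0] [ssg sa sb].
  have : valid_instr (sg, a0, b0) by rewrite -Ei; apply/(allP valp)/mem_nth.
  case/andP=> /= lta ltb.
  pose V c := exec (fun a => garr s 1 (a * n + c)) (take k p).
  have VS c : exec (fun a => garr s 1 (a * n + c)) (take k.+1 p) =
      exec_instr (V c) (sg, a0, b0).
    by rewrite (take_nth (false, 0, 0) lt_k) Ei -cats1 exec_cat.
  apply: (triple_for (b := 3) (I := fun i s' => forall a c, c < n ->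
    garr s' 1 (a * n + c) = if c < i then exec_instr (V c) (sg, a0, b0) a else V c a)
    w_gt0 ltn_w _ _ _ sn1) => //.
  + move=> i s2 lt_i [fw2 fa2 _ _] ii Ii; apply: triple_sem => //.
    have sg2 : wvar s2 v_g = k by rewrite fw2.
    have sn2 : wvar s2 v_n = n by rewrite fw2.
    have [dsg [da db]] : warr s2 a_sg k = sg /\ warr s2 a_dst k = a0 /\ warr s2 a_src k = b0.
      by case: fr1 => _ fa1 _ _; rewrite !fa2 // !fa1.
    have cella : eval w s2 (interpreter_cell a_dst) = a0 * n + i.
      by rewrite /= sg2 sn2 ii da (word_small (x := a0 * n)) ?word_small //; nia.
    have cellb : eval w s2 (interpreter_cell a_src) = b0 * n + i.
      by rewrite /= sg2 sn2 ii db (word_small (x := b0 * n)) ?word_small //; nia.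
    have Va : garr s2 1 (a0 * n + i) = V i a0 by rewrite Ii // ltnn.
    have Vb : garr s2 1 (b0 * n + i) = V i b0 by rewrite Ii // ltnn.
    have E : sem w interpreter_step s2 = set_garr s2 1 (a0 * n + i)
        (if sg then V i a0 - V i b0 else V i a0 + V i b0)%R.
      rewrite /interpreter_step; cbn beta iota delta [sem geval].
      rewrite !cella !cellb Va Vb.
      have -> : eval w s2 (WRead a_sg (WVar v_g)) = sg by rewrite /= sg2.
      by case: sg {Ei ssg VS Ii dsg}.
    rewrite E => a c ltc; rewrite /= /upd /= eq_cell // ltnS leq_eqVlt Ii //=.
    case: (c =P i) => [->|_] /=; last by rewrite andbF.
    by rewrite andbT /upd ltnn; case: (a =P a0).
  + by move=> s2 _ In a c ltc; rewrite /= In // ltc VS.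
- by move=> s' _; rewrite take_size.
- by lia.
Qed.

Lemma valid_full_prog L cs : all valid_instr
  (full_prog n M (random_phases n j M L cs (start n))).
Proof.
set Z := random_phases _ _ _ _ _ _.
have okZ : work_ok n Z by apply/work_ok_random_phases/work_ok_start.
have [uY ltY] := work_ok_rows okZ.
have vprog : all valid_instr (prog Z).
  rewrite /Z; have := work_ok_start n; have : all valid_instr (prog (start n)) by [].
  elim: L cs (start n) {Z okZ uY ltY} => //= L IH cs Z v okZ.
  apply: IH; last exact: work_ok_phase.
  have [uY ltY] := work_ok_rows okZ; have := work_ok_row_phase M (sample j (cols Z) cs n) okZ.
  case: (okZ) => _ uX ltX _ okZ'; have [_ ltY'] := work_ok_rows okZ'.
  rewrite /= !all_cat v /=; apply/andP; split; apply/allP => i.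
    case/flattenP => l /mapP[y]; rewrite mem_filter => /andP[_ Yy] ->.
    have lty := ltY y Yy; have ltr := ltY _ (proj1 (repP M (sample j (cols Z) cs n) Yy)).
    rewrite mem_cat inE => /orP[/mapP[x]|/eqP -> /=].
      by rewrite mem_filter => /andP[_ /ltX ltx] ->; rewrite /valid_instr /=; lia.
    by rewrite /valid_instr /=; lia.
  case/mapP => x; rewrite mem_filter => /andP[_ Xx] ->; have ltx := ltX x Xx.
  have ltr := ltX _ (proj1 (repP M (reps M (sample j (cols Z) cs n) (rows Z)) Xx)).
  by rewrite /valid_instr /=; lia.
case: okZ => pm uX ltX okE; rewrite /full_prog !all_cat vprog /=.
apply/andP; split; apply/allP => i.
  case/flattenP => l /mapP[y /ltY lty ->] /mapP[x].
  by rewrite mem_filter => /andP[_ /ltX ltx] ->; rewrite /valid_instr /=; lia.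
case/mapP => q; rewrite mem_rev => Eq ->.
have lt1 z : z \in rows Z ++ unzip1 (elim Z) -> z < n.
  by rewrite (perm_mem pm) mem_iota.
have h1 : q.1 < n by apply: lt1; rewrite mem_cat map_f ?orbT.
have h2 : q.2 < n.
  apply: lt1; elim: (elim Z) okE Eq {pm h1} => //= -[y z] E IH /and3P[hz _ okE].
  rewrite inE => /orP[/eqP -> /=|/(IH okE)]; rewrite !mem_cat inE.
    by move: hz; rewrite mem_cat => /orP[->|->]; rewrite ?orbT.
  by case/orP => ->; rewrite ?orbT.
by rewrite /valid_instr /= !ltn_addr.
Qed.

Lemma main_spec s : 0 < n -> base s -> wvar s v_L = 0 -> wvar s v_m = 0 ->
  wvar s v_ne = 0 ->
  let L := (trunc_log 2 n).+1 in
  let P := full_prog n M (random_phases n j M L (coins s) (start n)) in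
  triple w (main_cmd j) s (L.+1 * ((4 * j + 200) * n.+1 ^ 2) + size P * (n * 6 + 6))
    (fun s' => forall a c, a < n -> c < n -> garr s' 1 (a * n + c) =
       exec (fun a => if n <= a < n + n then garr s 0 ((a - n) * n + c)
                      else garr s 1 (a * n + c)) P a).
Proof.
move=> n0 sb sL sm sne L P.
have leLn : L <= n.
  have /andP[le _] := trunc_log_bounds (isT : 1 < 2) n0.
  by apply: leq_trans le; rewrite ltn_expl.
pose c1 := n * 9 + 7; pose c2 := L * n * (4 * j + 8) + 3; pose c3 := n * 6 + 7.
pose c4 := n * (n * 4 + 6) + 3; pose c5 := L * (120 * n.+1 ^ 2 + 3) + 3.
pose c6 := n * (n * 20 + 8) + 3; pose c7 := n * 16 + 3.
pose c8 := size P * (n * 6 + 6) + 3.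
pose d7 := (c7 + c8).+1; pose d6 := (c6 + d7).+1; pose d5 := (c5 + d6).+1.
pose d4 := (c4 + d5).+1; pose d3 := (c3 + d4).+1; pose d2 := (c2 + d3).+1.
apply: (@triple_seq _ _ _ _ _ c1 d2); last first.
  (* [B] covers the tosses and word operations of one phase, and once more all the remaining
     overhead apart from the interpreter, which explains [L.+1]. *)
  set B := (4 * j + 200) * n.+1 ^ 2.
  have hB : 200 * n.+1 ^ 2 <= B by rewrite leq_mul2r leq_addl orbT.
  have h0 : c1 + c3 + c4 + c6 + c7 + 20 <= B.
    by apply: leq_trans hB; rewrite /c1 /c3 /c4 /c6 /c7; nia.
  have hL : c2 + c5 <= L * B + 6.
    suff : L * n * (4 * j + 8) + L * (120 * n.+1 ^ 2 + 3) <= L * B by rewrite /c2 /c5; lia.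
    by rewrite -mulnA -mulnDr leq_mul2l /B; apply/orP; right; nia.
  by rewrite /d2 /d3 /d4 /d5 /d6 /d7 /c8 mulSn; clearbody c1 c2 c3 c4 c5 c6 c7 B; lia.
have sn := proj1 sb.
apply: (triple_conseq (count_phases_spec n0 sn sL)) => // s1 fr1 [sL1 sLN1].
have sb1 := base_frame fr1 isT isT sb.
have [fw1 _ fg1 fc1] := fr1.
apply: (@triple_seq _ _ _ _ _ c2 d3) => //.
apply: (triple_conseq (toss_spec (L := L) leLn sLN1 (fc1 isT))) => // s2 fr2 rnd2.
have fl := flips_mods j.
have fr2w x : x \notin [:: v_i; v_r; v_coin] -> wvar s2 x = wvar s1 x.
  rewrite !inE !negb_or => /and3P[h1 h2 h3]; case: fr2 => fw _ _ _; apply: fw.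
  by rewrite /= !inE cats0 mem_cat inE !negb_or h1 h2 flips_notin.
have fr2a a : a != a_rnd -> warr s2 a = warr s1 a.
  by move=> h; case: fr2 => _ fa _ _; apply: fa; rewrite /= fl.2.1 /= inE.
have fr2g a : garr s2 a = garr s1 a.
  by case: fr2 => _ _ fg _; apply: fg; rewrite /= fl.2.2.
have sb2 : base s2 by rewrite /base fr2w // fr2a.
apply: (@triple_seq _ _ _ _ _ c3 d4) => //.
apply: (triple_conseq (init_lists_spec (proj1 sb2))) => // s3 fr3 [sY3 sX3].
have sb3 := base_frame fr3 isT isT sb2.
apply: (@triple_seq _ _ _ _ _ c4 d5) => //.
apply: (triple_conseq (copy_input_spec (proj1 sb3))) => // s4 fr4 sV4.
have sb4 := base_frame fr4 isT isT sb3.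
have [fw3 fa3 fg3 _] := fr3; have [fw4 fa4 fg4 _] := fr4.
have sL4 : wvar s4 v_L = L by rewrite fw4 // fw3 // fr2w.
have rnd4 q : q < L * n -> warr s4 a_rnd q = bits_val j 0 (drop (q * j) (coins s)).
  by move=> lt; rewrite fa4 // fa3 // rnd2.
have sZ4 : work_at s4 (start n).
  split=> //=.
  - split; first exact: list_frame fr4 sY3.1 isT.
    by rewrite fw4 // sY3.2 size_iota.
  - split; first exact: list_frame fr4 sX3.1 isT.
    by rewrite fw4 // sX3.2 size_iota.
  - by split=> //=; rewrite fw4 // fw3 // fr2w // fw1.
  - by split=> //=; rewrite fw4 // fw3 // fr2w // fw1.
have sg4 a c : c < n -> garr s4 1 (a * n + c) =
    if n <= a < n + n then garr s 0 ((a - n) * n + c) else garr s 1 (a * n + c).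
  by move=> ltc; rewrite sV4 // !fg3 // !fr2g !fg1.
apply: (@triple_seq _ _ _ _ _ c5 d6) => //.
apply: (triple_conseq (phases_spec leLn sL4 sZ4 rnd4)) => // s5 fr5.
have [_ _ fg5 _] := fr5.
have ok5 := work_ok_random_phases j M L (coins s) (work_ok_start n).
have vP := valid_full_prog L (coins s).
have pot := potential_random_phases_n L (coins s) (work_ok_start n).
rewrite /P; set Z := random_phases _ _ _ _ _ _ in ok5 vP pot *.
case=> sb5 [sY5 sny5] [sX5 snx5] sp5 sE5.
have [uY ltY] := work_ok_rows ok5; have szE := work_ok_elim_size ok5.
case: (ok5) => _ uX ltX _.
have capp : size (prog Z) <= n * n.+2.
  by move: pot; rewrite /potential /= size_iota; lia.
apply: (@triple_seq _ _ _ _ _ c6 d7) => //.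
apply: (triple_conseq (brute_force_spec sb5 sX5 snx5 uX ltX sY5 sny5 uY ltY sp5 capp)) => //.
move=> s6 fr6 sp6; have sE6 := elim_frame fr6 isT isT sE5.
have sb6 := base_frame fr6 isT isT sb5; have [_ _ fg6 _] := fr6.
have capb : size (brute_force n M (cols Z) (rows Z)) <= n * n.
  by rewrite (leq_trans (size_brute_force _ _)) // leq_mul ?small_size.
apply: (@triple_seq _ _ _ _ _ c7 c8) => //.
apply: (triple_conseq (back_substitution_spec sE6 _ sp6 _)) => //.
- by rewrite -szE leq_addr.
- by rewrite size_cat leq_add.
move=> s7 fr7; rewrite -catA => sp7; have [_ _ fg7 _] := fr7.
have sb7 := base_frame fr7 isT isT sb6.
have capP : size (full_prog n M Z) < 4 * n.+1 ^ 2.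
  have : size (back_substitution (elim Z)) <= n by rewrite size_map size_rev -szE leq_addr.
  move=> capb'; apply: (@leq_ltn_trans (n * n.+2 + (n * n + n))); last exact: cap_prog.
  by rewrite /full_prog !size_cat !leq_add.
apply: (triple_conseq (interpreter_spec (proj1 sb7) sp7 capP vP)) => //.
move=> s8 _ s8g a c lta ltc; rewrite s8g //.
have E b : garr s7 1 (b * n + c) = if n <= b < n + n then garr s 0 ((b - n) * n + c)
    else garr s 1 (b * n + c) by rewrite fg7 // fg6 // fg5 // sg4.
have exec_ext (V V' : nat -> A) q : V =1 V' -> exec V q =1 exec V' q.
  elim: q V V' => //= -[[sg b] d] q IH V V' EV; apply: IH => z.
  by rewrite /= /upd !EV.
exact: exec_ext.
Qed.

End Verification.

(** * The theorem *)

From mathcomp Require Import all_classical all_reals all_analysis.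
Import numFieldNormedType.Exports.

Definition adj (n : nat) (M : 'M[bool]_n) (y x : nat) : bool :=
  match insub y : option 'I_n, insub x : option 'I_n with
  | Some i, Some k => M i k
  | _, _ => false
  end.

Lemma adj_ord (n : nat) (M : 'M[bool]_n) (i k : 'I_n) : adj M i k = M i k.
Proof. by rewrite /adj !valK. Qed.

Lemma flat_ord (T : Type) (d : T) (n : nat) (M : 'M[T]_n) (i k : 'I_n) :
  flat d M (i * n + k) = M i k.
Proof.
have n0 : 0 < n by apply: leq_ltn_trans (ltn_ord i).
rewrite /flat divnMDl // divn_small // addn0 modnMDl modn_small //.
by rewrite !valK.
Qed.

Lemma adj_shatter (G : graph) (d n : nat) (M : 'M[bool]_n) (T Y : seq nat) :
  twin_width_le G d -> adjacency_matrix G M -> uniq Y ->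
  {in T, forall t, t < n} -> {in Y, forall y, y < n} ->
  {in Y &, forall y z, agree (adj M) T y z -> y = z} ->
  size Y <= shatter_const d * size T + 1.
Proof.
move=> tw [s [bij_s ->]] uY ltT ltY sep.
(* [inord] needs a nonempty index type; for [n = 0] the list [Y] is empty. *)
case: n {M} s bij_s ltT ltY sep => [|n] s bij_s ltT ltY sep.
  by case: Y ltY {uY sep} => // y Y /(_ y (mem_head _ _)).
pose f k := s (inord k).
have adjE y x : y < n.+1 -> x < n.+1 ->
    adj (\matrix_(i, k) edge (s i) (s k)) y x = edge (f y) (f x).
  by move=> lty ltx; rewrite -[y](inordK lty) -[x](inordK ltx) adj_ord mxE /f !inordK.
have f_inj y z : y < n.+1 -> z < n.+1 -> f y = f z -> y = z.
  move=> lty ltz /(bij_inj bij_s)/(congr1 val); by rewrite /= !inordK.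
pose Xs := [set x in map f T]; pose Ys := [set y in map f Y].
have -> : size Y = #|Ys|.
  rewrite cardsE (card_uniqP _) ?size_map // map_inj_in_uniq // => y z Yy Yz.
  by apply: f_inj; apply: ltY.
apply: leq_trans (twin_width_separated (X := Xs) tw _) _.
  move=> v v'; rewrite !inE => /mapP[y Yy ->] /mapP[z Yz ->] E.
  congr f; apply: sep => //; apply/allP => t Tt.
  rewrite (adjE _ _ (ltY y Yy) (ltT t Tt)) (adjE _ _ (ltY z Yz) (ltT t Tt)) E //.
  by rewrite inE map_f.
rewrite leq_add2r leq_mul2l; apply/orP; right.
by rewrite cardsE (leq_trans (card_size _)) // size_map.
Qed.

(** * Unconditional correctness of the output *)

Section Correctness.
Variables (A : zmodType) (n j : nat) (M : 'M[bool]_n) (N : 'M[A]_n).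
Hypothesis n_gt0 : 0 < n.
Hypothesis M_sym : forall i k, M i k = M k i.
Local Notation L := (trunc_log 2 n).+1.
Local Notation alg := (Algorithm j.+4 (main_cmd j)).
Local Notation w := (word_size alg n).

Lemma adj_sym y x : adj M y x = adj M x y.
Proof. by rewrite /adj; case: insub => [i|]; case: insub => // k; rewrite M_sym. Qed.

(** Since [n + 1 <= 2 ^ L], two of the [j + 4] copies of [L] bits cover the square of [n + 1] and
    the other [j + 2] cover [4 * 2 ^ j]. *)
Lemma word_capacity : 2 ^ j * (4 * n.+1 ^ 2) <= 2 ^ w.
Proof.
rewrite /word_size /=; set l := L; have l0 : 0 < l by [].
have lt_n : n < 2 ^ l by have /andP[] := trunc_log_bounds (isT : 1 < 2) n_gt0.
have -> : j.+4 * l = (j + 2) * l + l * 2 by nia.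
rewrite expnD [2 ^ (l * 2)]expnM mulnA; apply: leq_mul; last by rewrite leq_exp2r.
by rewrite -[4]/(2 ^ 2) -expnD leq_exp2l //; nia.
Qed.

Lemma computes_random_phases (out V0 : nat -> A) m cs Z : work_ok n Z ->
  computes n (adj M) out (exec V0 (prog Z)) Z ->
  let Z' := random_phases n j (adj M) m cs Z in
  computes n (adj M) out (exec V0 (prog Z')) Z'.
Proof.
elim: m cs Z => //= m IH cs Z okZ cZ; apply: IH; first exact: work_ok_phase.
exact: computes_phase adj_sym _ _ _ _ _ _.
Qed.

(** No condition on the coins beyond the length of the recorded program. The registers start with
    zero rows below [n] and the rows of N above, for which the full row sums are the product. *)
Lemma alg_correct cs t :
  let Z := random_phases n j (adj M) L cs (start n) in
  L.+1 * ((4 * j + 200) * n.+1 ^ 2)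
    + size (full_prog n (adj M) Z) * (n * 6 + 6) <= t ->
  computes_within alg M N (bool_mulmx M N) t cs.
Proof.
move=> Z le_t; rewrite /computes_within; set s := initial_state w M N cs.
have cap := word_capacity.
have sb : base n (adj M) s.
  split; first by rewrite /= /upd /= (word_le_n cap) // leqnSn.
  move=> y x lty ltx; rewrite /= /upd /= -[y]/(val (Ordinal lty)) -[x]/(val (Ordinal ltx)).
  by rewrite flat_ord adj_ord (word_bool cap).
have [t0 [s' [le0 r out]]] := main_spec cap n_gt0 sb erefl erefl erefl.
have {}le0 : t0 <= t by apply: leq_trans le0 le_t.
rewrite -(subnK le0) iterD r.
(* A halted configuration is fixed by [step], so surplus time is harmless. *)
have -> : iter (t - t0) (step w) ([::], s') = ([::], s') by elim: (t - t0) => //= m ->.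
rewrite /halted /=; apply/forallP => i; apply/forallP => k.
rewrite out // -/Z; apply/eqP.
set V0 := (fun a : nat => _).
pose O := row_sum n (adj M) V0 (iota 0 n).
have V0lt a : a < n -> V0 a = 0%R by move=> lta; rewrite /V0 leqNgt lta.
have okZ : work_ok n Z by apply/work_ok_random_phases/work_ok_start.
rewrite (@exec_full_prog A n (adj M) O V0 Z) //; last first.
  apply: computes_random_phases; first exact: work_ok_start.
  apply: (@computes_start A n (adj M) O V0) => y lty.
  by rewrite V0lt // add0r.
rewrite mxE /O /row_sum.
have -> : iota 0 n = index_iota 0 n by rewrite /index_iota subn0.
rewrite big_mkord; apply: eq_big => x; first by rewrite adj_ord.
move=> _; rewrite /V0 leq_addr ltn_add2l ltn_ord /= addKn /upd /=.
exact: flat_ord.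
Qed.

End Correctness.

(** * Time bound, failure probability and asymptotics *)

Section Time.
Variables (j c a : nat).

(** Chosen so that [(1 - 1 / 2 ^ j) ^ deviation n <= 2 ^ -((a + 4) * L) <= n ^ -(a + 4)], with [L]
    the number of phases; the extra 4 pays for the union bound over phases and pairs of rows. *)
Definition deviation (n : nat) : nat := 2 ^ j * ((a + 4) * (trunc_log 2 n).+1).

Definition time_bound (n : nat) : nat :=
  (trunc_log 2 n).+2 * ((4 * j + 200) * n.+1 ^ 2)
  + n * (deviation n + (2 ^ j + 2 * c + 2) + 3) * (n * 6 + 6).

Lemma size_full_prog (n : nat) (M : nat -> nat -> bool) cs : 0 < n ->
  (forall T Y, uniq Y -> {in T, forall t, t < n} -> {in Y, forall y, y < n} ->
     {in Y &, forall y z, agree M T y z -> y = z} -> size Y <= c * size T + 1) ->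
  2 * (c * c) <= 2 ^ j ->
  ~~ bad_phases n j M (deviation n) (trunc_log 2 n).+1 cs (start n) ->
  size (full_prog n M (random_phases n j M (trunc_log 2 n).+1 cs (start n)))
  <= n * (deviation n + (2 ^ j + 2 * c + 2) + 3).
Proof.
move=> n0 shatter large good; set L := (trunc_log 2 n).+1 in good *.
have ok0 := work_ok_start n.
have := potential_random_phases ok0 good.
have := size_cols_random_phases shatter large L cs ok0.
have okZ := work_ok_random_phases j M L cs ok0.
set Z := random_phases _ _ _ _ _ _ in okZ *.
rewrite /potential /= size_iota; set tau := deviation n; set K := 2 ^ j + 2 * c + 2.
have ltn : n < 2 ^ L by have /andP[] := trunc_log_bounds (isT : 1 < 2) n0.
(* As [n < 2 ^ L], the initial excess has been halved below one. *)
move=> leX pot; have {}leX : size (cols Z) <= K.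
  by rewrite -ltnS -(ltn_pmul2l (expn_gt0 2 L)) mulnS; lia.
have szE : size (elim Z) + size (rows Z) = n by apply: work_ok_elim_size.
have leB : size (brute_force n M (cols Z) (rows Z)) <= n * K.
  apply: leq_trans (size_brute_force _ _ _ _) _; apply: leq_mul => //.
  by rewrite -szE leq_addl.
rewrite /full_prog !size_cat /back_substitution size_map size_rev.
have leE : size (elim Z) <= n by rewrite -szE leq_addr.
have : size (prog Z) <= n * tau.+1 + n by lia.
by move: leB leE; clear; nia.
Qed.

Lemma time_bound_le (n : nat) : 0 < n ->
  time_bound n <= (8 * (4 * j + 200) + 12 * (2 ^ j * (a + 4) + (2 ^ j + 2 * c + 2) + 3))
                  * (n ^ 2 * (trunc_log 2 n).+1).
Proof.
move=> n0; rewrite /time_bound /deviation; set l := trunc_log 2 n.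
set P := 2 ^ j * (a + 4); set K := 2 ^ j + 2 * c + 2; set J := 4 * j + 200.
rewrite [2 ^ j * (_ * _)]mulnA -/P.
have h1 : n.+1 ^ 2 <= 4 * n ^ 2 by clear -n0; nia.
have h2 : n * 6 + 6 <= 12 * n by lia.
have h3 : P * l.+1 + K + 3 <= (P + K + 3) * l.+1 by clear; nia.
rewrite [leqRHS]mulnDl; apply: leq_add.
  apply: (@leq_trans ((2 * l.+1) * (J * (4 * n ^ 2)))).
    by apply: leq_mul; [lia | rewrite leq_mul2l h1 orbT].
  by clear; nia.
apply: (@leq_trans (n * ((P + K + 3) * l.+1) * (12 * n))).
  by apply: leq_mul => //; rewrite leq_mul2l h3 orbT.
by clear; nia.
Qed.

End Time.

Section Failure.
Variables (R : realFieldType) (j c a n : nat) (M : nat -> nat -> bool).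
Hypothesis n_gt0 : 0 < n.
Local Notation L := (trunc_log 2 n).+1.
Local Notation bad cs := (bad_phases n j M (deviation j a n) L cs (start n)).
Local Open Scope ring_scope.

Lemma failure_probability :
  avg (time_bound j c a n) (fun cs => (bad cs)%:R) <= (n%:R ^+ a)^-1 :> R.
Proof.
have lt_n : (n < 2 ^ L)%N by have /andP[] := trunc_log_bounds (isT : (1 < 2)%N) n_gt0.
have le_Ln : (L <= n)%N.
  have /andP[le _] := trunc_log_bounds (isT : (1 < 2)%N) n_gt0.
  by apply: leq_trans le; rewrite ltn_expl.
(* The failure event reads only this many coins; the rest of the drawn ones average out. *)
have le_t : (L * (n * j) <= time_bound j c a n)%N.
  rewrite /time_bound; apply: leq_trans (leq_addr _ _); apply: leq_mul => //.
  by clear; nia.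
rewrite -(subnKC le_t) avg_add.
rewrite (@eq_avg _ _ _ (fun u => (bad u)%:R)); last first.
  move=> u szu; rewrite -[RHS](avg_const (time_bound j c a n - L * (n * j))).
  by apply: eq_avg => v _; rewrite bad_phases_cat // szu.
apply: le_trans (avg_bad_phases _ _ _ _ _ _) _; first by rewrite size_iota.
set p : R := 1 - _; have p0 : 0 <= p by apply: p_ge0.
have pK : p ^+ (2 ^ j)%N <= 2^-1 by apply: bernoulli_half; rewrite expn_gt0.
have n0 : 0 < n%:R :> R by rewrite ltr0n.
have le1 : p ^+ deviation j a n <= (n%:R ^+ (a + 4))^-1.
  rewrite /deviation exprM; apply: (@le_trans _ _ (2^-1 ^+ ((a + 4) * L))).
    by apply: lerXn2r; rewrite ?nnegrE ?exprn_ge0 ?invr_ge0 ?ler0n.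
  rewrite exprVn lef_pV2 ?posrE ?exprn_gt0 ?ltr0n // mulnC exprM.
  apply: lerXn2r; rewrite ?nnegrE ?exprn_ge0 ?ler0n //.
  by rewrite -natrX ler_nat ltnW.
(* The size of the union bound, at most [n ^ 3] because [L <= n]. *)
have le2 : ((L * (n * n))%:R : R) <= n%:R ^+ 4.
  rewrite -natrX ler_nat; apply: (@leq_trans (n * (n * n))).
    by rewrite leq_mul2r le_Ln orbT.
  by move: n_gt0; clear; nia.
apply: (@le_trans _ _ (n%:R ^+ 4 * (n%:R ^+ (a + 4))^-1)).
  by apply: ler_pM; rewrite ?ler0n ?exprn_ge0.
by rewrite exprD invfM mulrCA mulfV ?mulr1 // expf_neq0 // gt_eqF.
Qed.

End Failure.

Local Open Scope classical_set_scope.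
Local Open Scope ring_scope.

(** For [n > 1] the truncated logarithm is at least 1, so adding 1 at most doubles it; [n = 1] must
    be excluded because [ln 1 = 0]. *)
Lemma trunc_log_le_ln (R : realType) (n : nat) : (1 < n)%N ->
  (trunc_log 2 n).+1%:R <= 2 / ln 2 * ln n%:R :> R.
Proof.
move=> n1; have n0 : (0 < n)%N by apply: ltnW.
have ln2 : 0 < ln 2 :> R by rewrite ln_gt0 // ltr1n.
have /andP[le _] := trunc_log_bounds (isT : (1 < 2)%N) n0.
have tl1 : (0 < trunc_log 2 n)%N by rewrite trunc_log_gt0.
have h : (trunc_log 2 n)%:R * ln 2 <= ln n%:R :> R.
  rewrite mulr_natl -lnXn ?ltr0n // ler_ln ?posrE ?exprn_gt0 ?ltr0n //.
  by rewrite -natrX ler_nat.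
rewrite mulrAC ler_pdivlMr //.
apply: (@le_trans _ _ ((2 * trunc_log 2 n)%:R * ln 2)).
  by rewrite ler_pM2r // ler_nat; lia.
by rewrite natrM -mulrA ler_pM2l ?ltr0n.
Qed.

Lemma time_bound_bigO (R : realType) (j c a : nat) :
  (fun n : nat => (time_bound j c a n)%:R : R^o) =O_\oo
    (fun n : nat => n%:R ^+ 2 * ln n%:R : R^o).
Proof.
pose D := (8 * (4 * j + 200) + 12 * (2 ^ j * (a + 4) + (2 ^ j + 2 * c + 2) + 3))%N.
have ln2 : 0 < ln 2 :> R by rewrite ln_gt0 // ltr1n.
apply/eqO_exP; exists (D%:R * (2 / ln 2)).
  rewrite mulr_gt0 ?divr_gt0 ?ltr0n // /D; by clear; lia.
near=> n; have n1 : (1 < n)%N by near: n; exact: nbhs_infty_gt.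
have n0 : (0 < n)%N by apply: ltnW.
have lnn : 0 <= ln n%:R :> R by rewrite ln_ge0 // ler1n.
rewrite !ger0_norm ?mulr_ge0 ?exprn_ge0 ?ler0n //.
apply: (@le_trans _ _ (D * (n ^ 2 * (trunc_log 2 n).+1))%:R).
  by rewrite ler_nat time_bound_le.
rewrite natrM (natrM _ (n ^ 2)) natrX -[leRHS]mulrA ler_wpM2l ?ler0n //.
rewrite [X in _ <= X](_ : _ = n%:R ^+ 2 * (2 / ln 2 * ln n%:R)); last by ring.
by rewrite ler_wpM2l ?exprn_ge0 ?ler0n // trunc_log_le_ln.
Unshelve. all: by end_near.
Qed.

Theorem theorem1p7 (R : realType) (C : graph -> Prop)
    (hC : bounded_twin_width C) (A : zmodType) :
  exists alg : algorithm,
  forall c : R, 0 < c ->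
  exists T : nat -> nat,
    ((fun n : nat => (T n)%:R : R^o) =O_\oo
       (fun n : nat => n%:R ^+ 2 * ln n%:R : R^o)) /\
    forall (n : nat), (0 < n)%N ->
    forall (G : graph) (M : 'M[bool]_n) (N : 'M[A]_n),
      C G -> adjacency_matrix G M ->
      1 - n%:R `^ (- c) <=
        prob_computes_within R alg M N (bool_mulmx M N) (T n).
Proof.
have [d tww] := hC; pose sc := shatter_const d.
(* A crude choice: [x < 2 ^ x] already makes the blocks large enough, and [j] ignores the exponent
   [c]. *)
pose j := (2 * (sc * sc))%N.
have large : (2 * (sc * sc) <= 2 ^ j)%N by rewrite ltnW // ltn_expl.
exists (Algorithm j.+4 (main_cmd j)) => c c_gt0.
(* A natural number above [c], so that [n ^ -a <= n ^ -c]; it affects the time bound only. *)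
pose a := Num.bound c; exists (time_bound j sc a); split.
  exact: time_bound_bigO.
move=> n n_gt0 G M N CG adjM; set T := time_bound j sc a n.
have M_sym i k : M i k = M k i.
  by case: adjM => s [_ ->]; rewrite !mxE edge_sym.
pose bad cs := bad_phases n j (adj M) (deviation j a n) (trunc_log 2 n).+1 cs (start n).
rewrite /prob_computes_within -(avg_card R T (computes_within _ M N _ T)).
(* The comparison is then pointwise: on coins that are not bad the recorded program is short enough,
   so the run halts in time with the right output. *)
apply: (@le_trans _ _ (1 - avg T (fun cs => (bad cs)%:R : R))).
  rewrite lerD2l lerN2; apply: le_trans (failure_probability R j sc a _ n_gt0) _.
  rewrite powRN lef_pV2 ?posrE ?exprn_gt0 ?powR_gt0 ?ltr0n //.
  rewrite -powR_mulrn ?ler0n //; apply: ler_powR; first by rewrite ler1n.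
  by apply: ltW; apply: archi_boundP; apply: ltW.
rewrite -[X in X - _](avg_const T) -mulN1r -avgZ -avgD.
apply: avg_le => cs _; rewrite mulN1r.
case good: (bad cs); first by rewrite subrr ler0n.
rewrite subr0 alg_correct //.
have := @size_full_prog j sc a n (adj M) cs n_gt0 _ large (negbT good).
move=> le; rewrite /T /time_bound leq_add2l leq_mul2r le ?orbT //.
move=> X Y uY ltX ltY sep; exact: adj_shatter (tww G CG) adjM uY ltX ltY sep.
Qed.
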